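(* Fix an integer dimension $k\ge1$. For any sequence $(b_n)_{n\ge1}$ of nonnegative reals satisfying $b_n\to0$ and $n b_n\to\infty$, the following hold: $$\lim_{n\to\infty}\frac{\mathrm{OPT}_n(b_n)}{n\,b_n}=C_k\quad(\text{for every }k\ge1),\qquad \lim_{n\to\infty}\frac{\mu_n(\mathsf A_n(b_n))}{n\,b_n}=C_k\quad(\text{if }k\ge2),$$ and $$\lim_{n\to\infty}\frac{U_n(b_n)}{n\,b_n^{k}}=\kappa_k .$$ Consequently, $$\lim_{n\to\infty}\frac{U_n(b_n)}{\mathrm{OPT}_n(b_n)}=\frac{\kappa_k}{C_k}\lim_{n\to\infty}b_n^{k-1}=\mathbf 1_{\{k=1\}}.$$
   Context: Spatial matching model: fix the dimension $k$. There are $n$ supply nodes with locations $s_1,\ldots,s_n$ and $n$ demand nodes with locations $d_1,\ldots,d_n$; all $2n$ locations are mutually independent and uniform on $[0,1]^k$. For a deterministic vector $\mathsf R=(r_1,\ldots,r_n)\in[0,\infty)^n$ of normalized service radii, $G_n(\mathsf R)$ is the random bipartite graph between supply nodes and demand nodes in which supply $i$ and demand $j$ are adjacent if and only if $\|s_i-d_j\|_2\le r_i\,n^{-1/k}$. $M(G)$ denotes the cardinality of a maximum matching of $G$, and $\mu_n(\mathsf R):=\mathbb E[M(G_n(\mathsf R))]$. For $b\ge0$, $$\mathrm{OPT}_n(b):=\max\Big\{\mu_n(\mathsf R):\ \mathsf R\in[0,\infty)^n,\ \sum_{i=1}^n r_i=nb\Big\}$$ (the maximum is attained). $\kappa_k:=\pi^{k/2}/\Gamma(1+k/2)$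 is the volume of the Euclidean unit ball in $\mathbb R^k$. For $r\ge0$, $g_k(r):=1-\exp(-\kappa_k r^k)$. For $k\ge2$, $C_k:=\max_{r>0}g_k(r)/r$ and $r_k$ is the (unique) maximizer $\arg\max_{r>0}g_k(r)/r$. For $k=1$, $C_1:=\sup_{r>0}g_1(r)/r=2$. Activation allocation: for $k\ge2$ and $0\le b\le r_k$, let $m=\lfloor nb/r_k\rfloor$ and $\eta=nb-m r_k$. $\mathsf A_n(b)\in[0,\infty)^n$ assigns radius $r_k$ to $m$ supply nodes, radius $\eta$ to one further supply node if $\eta>0$, and zero to all others (if $m=n$ then $\eta=0$); the indices of supply nodes with positive radius are fixed before locations are sampled. Since $b_n\to0$, $\mathsf A_n(b_n)$ is defined for all sufficiently large $n$. Uniform allocation: for $b\ge0$, $U_n(b):=\mu_n(b\mathbf 1)$, where $\mathbf 1$ is the all-ones vector in $\mathbb R^n$. *)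

(* Defs.v *)
From HB Require Import structures.
From mathcomp Require Import all_boot all_order all_algebra all_fingroup.
From mathcomp Require Import all_classical all_reals all_analysis.

Set Implicit Arguments.
Unset Strict Implicit.
Unset Printing Implicit Defensive.

Import Order.TTheory GRing.Theory Num.Theory.
Import numFieldNormedType.Exports.

Local Open Scope classical_set_scope.
Local Open Scope ring_scope.

Section ProductProbability.
Context d (T : measurableType d) (R : realType).

Definition tuple_cons n (x : T * n.-tuple T) : n.+1.-tuple T :=
  [tuple of x.1 :: x.2].

Lemma measurable_tuple_cons n :
  measurable_fun [set: T * n.-tuple T] (@tuple_cons n).
Proof. exact: measurable_cons. Qed.

HB.instance Definition _ n :=
  isMeasurableFun.Build _ _ _ _ (@tuple_cons n) (@measurable_tuple_cons n).

(* The n-fold product measure, i.e. the joint law of n independent random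
   elements of law P. *)
Fixpoint prod_prob (P : probability T R) n : probability (n.-tuple T) R :=
  match n with
  | 0 => dirac [tuple]
  | n'.+1 => distribution (P \x prod_prob P n')%E (@tuple_cons n')
  end.

End ProductProbability.

Section Constants.
Context {R : realType}.
Implicit Types (A : set R) (k : nat) (r x : R).

(* The maximum of A, with default value 0 when A has no largest element. *)
Definition set_max A : R := xget 0 (A `&` ubound A).

Definition Gamma x : R :=
  (\int[lebesgue_measure]_(t in `]0, +oo[) (t `^ (x - 1) * expR (- t)))%R.

Definition kappa k : R := pi `^ (k%:R / 2) / Gamma (1 + k%:R / 2).

Definition gk k r : R := 1 - expR (- (kappa k * r ^+ k)).

Definition ratios k : set R := [set gk k r / r | r in [set r | 0 < r]].

(* For k = 1 the supremum, which equals 2, is not attained. *)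
Definition Ck k : R := if (2 <= k)%N then set_max (ratios k) else sup (ratios k).

(* The maximizer of gk k r / r over r > 0, which exists and is unique for
   k >= 2. *)
Definition rk k : R := xget 0 [set r | 0 < r /\ ubound (ratios k) (gk k r / r)].

End Constants.

Section Matching.
Context {S D : finType}.
Implicit Types (e : S -> D -> bool) (M : {set S * D}).

Definition is_matching e M : bool :=
  [forall p in M, e p.1 p.2] &&
  [forall p in M, forall q in M,
     (p != q) ==> (p.1 != q.1) && (p.2 != q.2)].

Definition matching_number e : nat := \max_(M | is_matching e M) #|M|.

End Matching.

(* [measurableTypeR R] is R with its Borel sigma-algebra. *)
Notation point R k := (k.-tuple (measurableTypeR R)).

Section Model.
Context {R : realType}.
Implicit Types (k n : nat) (b : R).

Definition euclidean_dist k (x y : point R k) : R :=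
  Num.sqrt (\sum_(c < k) (tnth x c - tnth y c : R) ^+ 2).

Definition uniform_cube k : probability (point R k) R :=
  prod_prob (uniform_prob (@ltr01 R)) k.

(* The joint law of the n supply and the n demand locations. *)
Definition location_law k n :
    probability (n.-tuple (point R k) * n.-tuple (point R k))%type R :=
  (prod_prob (uniform_cube k) n \x prod_prob (uniform_cube k) n)%E.

Definition adjacent k n (r : 'rV[R]_n)
    (w : n.-tuple (point R k) * n.-tuple (point R k)) (i j : 'I_n) : bool :=
  euclidean_dist (tnth w.1 i) (tnth w.2 j) <= r 0 i * n%:R `^ (- k%:R^-1).

Definition mu k n (r : 'rV[R]_n) : R :=
  fine 'E_(location_law k n)[fun w => (matching_number (adjacent r w))%:R].

Definition OPT k n b : R :=
  set_max [set mu k r | r in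
    [set r : 'rV[R]_n | (forall i, 0 <= r 0 i) /\ \sum_i r 0 i = n%:R * b]].

(* The permutation s chooses which supply nodes are activated. *)
Definition activation k n b (s : 'S_n) : 'rV[R]_n :=
  let m := Num.truncn (n%:R * b / rk k) in
  \row_i (if (s i < m)%N then rk k
          else if s i == m :> nat then n%:R * b - m%:R * rk k
          else 0).

Definition Un k n b : R := mu k (const_mx b : 'rV[R]_n).

End Model.

(* Main.v *)
Require Import Defs.
From HB Require Import structures.
From mathcomp Require Import all_boot all_order all_algebra all_fingroup.
From mathcomp Require Import all_classical all_reals all_analysis.
From mathcomp Require Import measurable_realfun ring lra.
Import Order.TTheory GRing.Theory Num.Theory.
Import numFieldNormedType.Exports.
Local Open Scope classical_set_scope.
Local Open Scope ring_scope.

(** Why the limits hold.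

    Upper bound. The size of a matching is at most the number of supply nodes
    with at least one neighbour. A supply node of normalized radius [r] has a
    service ball of volume at most [kappa k * r ^+ k / n], so it has a neighbour
    with probability at most [1 - (1 - kappa k * r ^+ k / n) ^+ n] (at most 1 when
    the volume exceeds that of the cube), which is at most
    [(1 + 2 / n) * gk k r] ([coverage_le_exp]), uniformly in [r]. As
    [gk k r <= Ck k * r], a budget [n * b] never yields more than
    [(1 + 2 / n) * Ck k * (n * b)] expected matches ([mu_le_ratio]).

    Lower bound. Suppose that the nodes of a set [A] all have radius [a]. Each is
    covered with probability at least [gk k a], up to a factor for the locations
    too close to the boundary of the cube, which tends to 1. Covered nodes can be
    matched simultaneously except for those that contend for a demand node, and a
    pair contends with probability at most [(kappa k * a ^+ k) ^+ 2 / n]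
    ([mu_ge]). For k >= 2 the ratio [gk k r / r] has a maximizer [rk k];
    activating about [n * b / rk k] nodes at this radius gives [Ck k] matches per
    unit of budget, and the [O((n * b) ^+ 2 / n)] contending pairs are negligible
    since [b] tends to 0. When all nodes have radius [b], the same estimate gives
    [n * gk k b], which is about [n * (kappa k * b ^+ k)]; for k = 1 this
    meets the upper bound, because [Ck 1 = kappa 1] ([Ck1]).

    Geometry. All this requires that [kappa k], defined by the Gamma function, is
    the volume of the unit ball ([ball_vol1]). The volume is defined by slicing
    ([ball_vol]) and found from its Laplace transform, which is a product of
    Gaussian integrals. Comparing the same slices inside the cube bounds the
    mass of balls and shells under the uniform law.

    The optimum is a value and not merely a supremum because the expected
    matching size is continuous in the radii ([mu_dist]) and allocations of a
    given budget form a compact set. *)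

Set Implicit Arguments.
Unset Strict Implicit.
Unset Printing Implicit Defensive.

(** * Affine change of variables for the Lebesgue measure *)

Section LebesgueAffine.
Context {R : realType}.
Notation leb := (@lebesgue_measure R).
Local Open Scope ereal_scope.

Definition affine (a c : R) (x : measurableTypeR R) : measurableTypeR R :=
  (a * x + c)%R.

Lemma measurable_affine (a c : R) : measurable_fun setT (affine a c).
Proof. by apply: measurable_funD => //; apply: measurable_funM. Qed.

(** By uniqueness of the Lebesgue measure it is enough to compare both sides on
    half-open intervals. Translations and dilations are the only changes of
    variables that the volume of balls requires. *)
Lemma lebesgue_affine (a c : R) : (0 < a)%R ->
  forall A, measurable A ->
  leb A = a%:E * pushforward leb (affine a c) A.
Proof.
move=> a0.
have maff := measurable_affine a c.
have @m : {measure set (measurableTypeR R) -> \bar R}.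
  by refine (mscale (NngNum (ltW a0)) (pushforward leb (affine a c))).
suff H : forall X, ocitv X -> leb X = m X.
  by move=> A mA; rewrite (lebesgue_measure_unique H).
move=> X [[u v]/= _ <-].
rewrite /m /= /mscale /= /pushforward.
have -> : affine a c @^-1` `]u, v]%classic =
    `](a^-1 * (u - c))%R, (a^-1 * (v - c))%R]%classic.
  apply/seteqP; split => x /=; rewrite /affine !in_itv/=.
    by rewrite ltr_pdivrMl// ler_pdivlMl// ltrBlDr lerBrDr.
  by rewrite ltr_pdivrMl// ler_pdivlMl// ltrBlDr lerBrDr.
rewrite !lebesgue_measure_itv/= !lte_fin ltr_pM2l ?invr_gt0// ltrD2r.
case: ifPn => _; last by rewrite mule0.
rewrite -!EFinD -EFinM; congr (_%:E).
by rewrite mulrBr !mulrA !mulfV ?gt_eqF// !mul1r opprB addrA subrK.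
Qed.

Lemma ge0_integral_affine (a c : R) (f : measurableTypeR R -> \bar R) : (0 < a)%R ->
  measurable_fun setT f -> (forall x, 0 <= f x) ->
  \int[leb]_x f x = a%:E * \int[leb]_x f (a * x + c)%R.
Proof.
move=> a0 mf f0.
have maff := measurable_affine a c.
have @m : {measure set (measurableTypeR R) -> \bar R}.
  by refine (pushforward leb (affine a c)).
have := @ge0_integral_pushforward _ _ _ _ R _ maff leb setT f measurableT mf
  (fun y _ => f0 y).
rewrite preimage_setT => /= H.
transitivity (\int[mscale (NngNum (ltW a0)) m]_x f x).
  apply: eq_measure_integral => A mA _.
  exact: (lebesgue_affine c a0).
rewrite ge0_integral_mscale//=.
by congr (_ * _); exact: H.
Qed.

End LebesgueAffine.

(** * The volume of Euclidean balls *)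

Lemma sqrtrX_powR {R : realType} (x : R) k : 0 <= x ->
  Num.sqrt x ^+ k = x `^ (k%:R / 2).
Proof.
by move=> x0; rewrite -powR12_sqrt// -powR_mulrn ?powR_ge0// -powRrM mulrC.
Qed.

Section BallVolume.
Context {R : realType}.
Notation leb := (@lebesgue_measure R).
Local Open Scope ereal_scope.

(** The volume of the k-dimensional ball of squared radius [t], obtained by slicing
    along one coordinate at a time. This avoids Lebesgue measure on R^k, and the
    slices of a product law on tuples obey the same recursion. Taking the squared
    radius as the parameter turns slicing into the subtraction of [x ^+ 2]. *)
Fixpoint ball_vol k (t : R) : \bar R :=
  if k is k'.+1 then \int[leb]_x ball_vol k' (t - x ^+ 2)%R
  else ((0 <= t)%R%:R)%:E.

Lemma ball_vol_ge0 k t : 0 <= ball_vol k t.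
Proof.
elim: k t => [|k IH] t /=; first by rewrite lee_fin ler0n.
by apply: integral_ge0 => x _; exact: IH.
Qed.

Lemma measurable_ball_vol k :
  measurable_fun setT (ball_vol k : measurableTypeR R -> \bar R).
Proof.
elim: k => [|k IH] /=.
  apply/measurable_EFinP; apply: measurableT_comp => //=.
  exact: measurable_fun_ler.
apply: (@measurable_fun_fubini_tonelli_F _ _ (measurableTypeR R)
  (measurableTypeR R) R leb (fun z => ball_vol k (z.1 - z.2 ^+ 2)%R)); last first.
  by move=> x; exact: ball_vol_ge0.
apply: (measurableT_comp IH).
apply: measurable_funB; first exact: measurable_fst.
by apply: measurable_funX; exact: measurable_snd.
Qed.

Lemma measurable_ball_vol_sub_sqr k (t : R) (f : measurableTypeR R -> R) :
  measurable_fun setT f ->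
  measurable_fun setT (fun x => ball_vol k (t - f x ^+ 2)%R).
Proof.
move=> mf; apply: (measurableT_comp (measurable_ball_vol k)).
by apply: measurable_funB => //; exact: measurable_funX.
Qed.

Lemma ball_vol_lt0 k t : (t < 0)%R -> ball_vol k t = 0.
Proof.
elim: k t => [|k IH] t t0 /=; first by rewrite leNgt t0.
rewrite integral0_eq// => x _; apply: IH.
by rewrite subr_lt0 (lt_le_trans t0)// sqr_ge0.
Qed.

Lemma ball_vol_center k t (c : R) :
  ball_vol k.+1 t = \int[leb]_x ball_vol k (t - (c - x) ^+ 2)%R.
Proof.
rewrite /= (@ge0_integral_affine _ 1 (- c))//.
- rewrite mul1e; apply: eq_integral => x _.
  by rewrite mul1r -[(c - x)%R]opprB sqrrN.
- exact: measurable_ball_vol_sub_sqr.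
- by move=> x; exact: ball_vol_ge0.
Qed.

(** The dilation [x = a * y] of the slicing variable gives the factor [a] at each
    step; so the volume is known up to its value at radius 1. *)
Lemma ball_vol_homog k (a t : R) : (0 < a)%R ->
  ball_vol k (a ^+ 2 * t)%R = (a ^+ k)%:E * ball_vol k t.
Proof.
move=> a0; elim: k t => [|k IH] t /=.
  by rewrite expr0 mul1e pmulr_rge0// exprn_gt0.
rewrite (@ge0_integral_affine _ a 0)//; last 2 first.
- exact: measurable_ball_vol_sub_sqr.
- by move=> x; exact: ball_vol_ge0.
rewrite (exprS a k) EFinM -muleA; congr (_ * _).
rewrite -ge0_integralZl//; last 3 first.
- exact: measurable_ball_vol_sub_sqr.
- by move=> x _; exact: ball_vol_ge0.
- by rewrite lee_fin exprn_ge0// ltW.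
apply: eq_integral => x _.
by rewrite -IH addr0 exprMn mulrBr.
Qed.

Let expball k (t : measurableTypeR R) := (expR (- t))%:E * ball_vol k t.

Lemma measurable_expball k : measurable_fun setT (expball k).
Proof.
apply: emeasurable_funM; last exact: measurable_ball_vol.
by apply/measurable_EFinP; apply: measurableT_comp => //; exact: measurable_oppr.
Qed.

Lemma expball_ge0 k t : 0 <= expball k t.
Proof. by rewrite mule_ge0// ?ball_vol_ge0// lee_fin expR_ge0. Qed.

(** The Gaussian trick: by Tonelli and the translation [t = u + x ^+ 2], each
    dimension contributes a factor that is the integral of [expR (- x ^+ 2)].
    With homogeneity this determines the volume of the unit ball without any
    Beta integral. *)
Lemma integral_expball k : \int[leb]_t expball k t = ((Num.sqrt pi) ^+ k)%:E.
Proof.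
elim: k => [|k IH].
  rewrite expr0 -(integral_exponential_pdf (@ltr01 R)).
  apply: eq_integral => t _; rewrite /expball /= /exponential_pdf patchE.
  by rewrite mem_setE in_itv/= andbT; case: ifP => _; rewrite ?mule0// mule1 mul1r mulN1r.
pose F (z : measurableTypeR R * measurableTypeR R) :=
  (expR (- z.1))%:E * ball_vol k (z.1 - z.2 ^+ 2)%R.
have F0 z : 0 <= F z by rewrite mule_ge0// ?ball_vol_ge0// lee_fin expR_ge0.
have msub : measurable_fun setT (fun z : measurableTypeR R * measurableTypeR R =>
    (z.1 - z.2 ^+ 2)%R : measurableTypeR R).
  apply: measurable_funB; first exact: measurable_fst.
  by apply: measurable_funX; exact: measurable_snd.
have mF : measurable_fun setT F.
  apply: emeasurable_funM; last first.
    by apply: (measurableT_comp (measurable_ball_vol k)).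
  apply/measurable_EFinP; apply: measurableT_comp => //.
  by apply: measurableT_comp => //; exact: measurable_fst.
transitivity (\int[leb]_t \int[leb]_x F (t, x)).
  apply: eq_integral => t _; rewrite /expball /= -ge0_integralZl ?lee_fin ?expR_ge0//.
  - exact: measurable_ball_vol_sub_sqr.
  - by move=> x _; exact: ball_vol_ge0.
rewrite (fubini_tonelli F)//.
transitivity (\int[leb]_x ((gauss_fun x)%:E * (Num.sqrt pi ^+ k)%:E)).
  apply: eq_integral => x _.
  rewrite (@ge0_integral_affine _ 1 (x ^+ 2))//; last first.
    by apply: measurableT_comp => //; exact: measurable_pair2.
  rewrite mul1e -IH -ge0_integralZl//; last 3 first.
  - exact: measurable_expball.
  - by move=> t _; exact: expball_ge0.
  - by rewrite lee_fin gauss_fun_ge0.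
  apply: eq_integral => t _.
  rewrite /F /expball /= mul1r addrK muleA -EFinM /gauss_fun -expRD.
  by rewrite opprD addrC.
rewrite ge0_integralZr//; last 2 first.
- by apply: measurableT_comp => //; exact: measurable_gauss_fun.
- by move=> x _; rewrite lee_fin gauss_fun_ge0.
by rewrite integralT_gauss -EFinM -exprS.
Qed.

(** By homogeneity the integrand is [t `^ (k / 2) * expR (- t)] times the volume of
    the unit ball, which is where the Gamma function of [kappa] comes from. *)
Lemma integral_expball_Gamma k :
  \int[leb]_t expball k t =
  (\int[leb]_(t in `]0%R, +oo[) (t `^ (k%:R / 2) * expR (- t))%:E) * ball_vol k 1%R.
Proof.
have mp : measurable_fun setT
    (fun t : measurableTypeR R => (t `^ (k%:R / 2) * expR (- t))%:E).
  apply/measurable_EFinP; apply: measurable_funM; first exact: measurable_powR.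
  by apply: measurableT_comp => //; exact: measurable_oppr.
rewrite -ge0_integralZr ?ball_vol_ge0//; last 2 first.
- exact: measurable_funTS.
- by move=> t _; rewrite lee_fin mulr_ge0 ?powR_ge0 ?expR_ge0.
transitivity (\int[leb]_(t in `[0%R, +oo[) expball k t).
  rewrite [RHS]integral_mkcond; apply: eq_integral => t _; rewrite patchE.
  rewrite mem_setE in_itv/= andbT; case: ifPn => //; rewrite -ltNge => t0.
  by rewrite /expball ball_vol_lt0// mule0.
rewrite -integral_itv_obnd_cbnd; last first.
  by apply: measurable_funTS; exact: measurable_expball.
apply: eq_integral => t; rewrite mem_setE in_itv/= andbT => t0.
rewrite /expball -[in ball_vol k t](sqr_sqrtr (ltW t0)) -[X in ball_vol k X]mulr1.
rewrite ball_vol_homog ?sqrtr_gt0// sqrtrX_powR ?ltW//.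
by rewrite muleA -EFinM mulrC.
Qed.

Lemma ball_vol1 k : ball_vol k 1%R = (kappa k)%:E.
Proof.
have := integral_expball_Gamma k; rewrite integral_expball => /esym.
rewrite sqrtrX_powR ?pi_ge0//.
set G := \int[leb]_(t in _) _.
have G0 : 0 <= G.
  by apply: integral_ge0 => t _; rewrite lee_fin mulr_ge0 ?powR_ge0 ?expR_ge0.
have -> : kappa k = (pi `^ (k%:R / 2) / fine G)%R :> R.
  rewrite /kappa /Gamma /Rintegral; congr (_ / fine _)%R.
  by apply: eq_integral => t _; rewrite addrAC subrr add0r.
have P0 : (0 < pi `^ (k%:R / 2) :> R)%R by rewrite powR_gt0// pi_gt0.
have := ball_vol_ge0 k 1%R.
(* the product of the two factors is finite and positive, so neither is infinite *)
case: (ball_vol k 1%R) => [c| |]//; case: G G0 => [g| |]//.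
- rewrite -EFinM /= => _ _ [gcE]; rewrite -gcE mulrAC mulfV ?mul1r//.
  by apply: contraTneq P0 => g0; rewrite -gcE g0 mul0r ltxx.
- move=> _; rewrite lee_fin le_eqVlt => /predU1P[<-|c0].
    by rewrite mule0 => -[P0E]; rewrite -P0E ltxx in P0.
  by rewrite gt0_mulye.
- rewrite lee_fin le_eqVlt => /predU1P[<-|g0] _.
    by rewrite mul0e => -[P0E]; rewrite -P0E ltxx in P0.
  by rewrite gt0_muley.
Qed.

Lemma kappa_ge0 k : (0 <= kappa k :> R)%R.
Proof. by rewrite -lee_fin -ball_vol1 ball_vol_ge0. Qed.

Lemma ball_volE k (t : R) : (0 <= t)%R ->
  ball_vol k (t ^+ 2)%R = (kappa k * t ^+ k)%:E.
Proof.
(* homogeneity does not cover t = 0: there only the slice at 0 can contribute *)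
rewrite le_eqVlt => /predU1P[<-|t0]; last first.
  by rewrite -[(t ^+ 2)%R]mulr1 ball_vol_homog// ball_vol1 -EFinM mulrC.
case: k => [|k].
  by rewrite expr0 mulr1 -ball_vol1 /= expr0n/= lexx ler01.
rewrite (exprS 0%R k) (exprS 0%R 1%N) !mul0r mulr0.
rewrite (_ : ball_vol k.+1 0 = \int[leb]_(x in [set: R] `\ 0%R) ball_vol k (0 - x ^+ 2)%R).
  apply: integral0_eq => x [_ /= /eqP x0]; apply: ball_vol_lt0.
  by rewrite sub0r oppr_lt0 exprn_even_gt0.
rewrite integral_setD1//.
  exact: measurableD.
apply/measurable_funTS.
exact: measurable_ball_vol_sub_sqr.
Qed.

Lemma kappa_gt0 k : (0 < kappa k :> R)%R.
Proof.
rewrite lt_neqAle kappa_ge0 andbT; apply/eqP => k0.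
have : \int[leb]_t expball k t = 0.
  apply: integral0_eq => t _; rewrite /expball.
  have [t0|t0] := leP 0%R t; last by rewrite ball_vol_lt0// mule0.
  by rewrite -(sqr_sqrtr t0) ball_volE// -k0 mul0r mule0.
rewrite integral_expball => -[] /eqP.
by rewrite gt_eqF// exprn_gt0// sqrtr_gt0 pi_gt0.
Qed.

End BallVolume.

(** * Balls intersected with the unit cube *)

Section CubeBalls.
Context {R : realType}.
Notation leb := (@lebesgue_measure R).
Local Open Scope ereal_scope.
Implicit Types (k : nat) (t : R).

Definition sqdist k (x y : Defs.point R k) : R :=
  (\sum_(c < k) (tnth x c - tnth y c : R) ^+ 2)%R.

Definition sqball k (x : Defs.point R k) t : set (Defs.point R k) :=
  [set y | (sqdist x y <= t)%R].

Lemma measurable_sqdist d (T : measurableType d) k (f g : T -> Defs.point R k) :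
  measurable_fun setT f -> measurable_fun setT g ->
  measurable_fun setT (fun w => sqdist (f w) (g w)).
Proof.
move=> mf mg; apply: measurable_sum => c; apply: measurable_funX.
by apply: measurable_funB; exact: (measurableT_comp (measurable_tnth _)).
Qed.

Lemma measurable_sqdist_le d (T : measurableType d) k (f g : T -> Defs.point R k) t :
  measurable_fun setT f -> measurable_fun setT g ->
  measurable [set w | (sqdist (f w) (g w) <= t)%R].
Proof.
move=> mf mg; rewrite -[X in measurable X]setTI.
rewrite (_ : [set w | _] = (fun w => sqdist (f w) (g w)) @^-1` `]-oo, t]%classic).
  by apply: measurable_sqdist.
by apply/seteqP; split => w /=; rewrite in_itv.
Qed.

Lemma measurable_sqball k (x : Defs.point R k) t : measurable (sqball x t).
Proof. exact: measurable_sqdist_le. Qed.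

Lemma sqdist_ge0 k (x y : Defs.point R k) : (0 <= sqdist x y)%R.
Proof. by apply: sumr_ge0 => c _; exact: sqr_ge0. Qed.

Lemma sqdist_cons k (a u : R) (x y : Defs.point R k) :
  sqdist ([tuple of a :: x] : Defs.point R k.+1) [tuple of u :: y] =
  ((a - u) ^+ 2 + sqdist x y)%R.
Proof.
rewrite /sqdist big_ord_recl !tnth0; congr (_ + _)%R.
by apply: eq_bigr => c _; rewrite !tnthS.
Qed.

Lemma measurable_cube_slice k (a t : R) (x : Defs.point R k) :
  measurable_fun setT (fun u : measurableTypeR R =>
    uniform_cube k (sqball x (t - (a - u) ^+ 2)%R)).
Proof.
pose A := [set z : measurableTypeR R * Defs.point R k |
  ((a - z.1) ^+ 2 + sqdist x z.2 <= t)%R].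
have mA : measurable A.
  rewrite -[X in measurable X]setTI.
  rewrite (_ : A = (fun z => (a - z.1) ^+ 2 + sqdist x z.2)%R @^-1` `]-oo, t]%classic).
    apply: measurable_funD => //; last exact: measurable_sqdist.
    by apply: measurable_funX; apply: measurable_funB.
  by apply/seteqP; split => w /=; rewrite in_itv.
have := measurable_fun_xsection (uniform_cube k) mA.
congr measurable_fun; apply/funext => u /=; congr (uniform_cube k _).
by apply/seteqP; split => y; rewrite /xsection/= inE /A /sqball/= lerBrDl.
Qed.

(** Slicing along the first coordinate: the recursion of [ball_vol], with the
    slicing variable confined to the unit interval. *)
Lemma cube_sqballS k (a t : R) (x : Defs.point R k) :
  uniform_cube k.+1 (sqball ([tuple of a :: x] : Defs.point R k.+1) t) =
  \int[leb]_u ((fun u : measurableTypeR R => uniform_cube k (sqball x (t - (a - u) ^+ 2)%R))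
                \_ `[0%R, 1%R]) u.
Proof.
rewrite -integral_mkcond.
transitivity (\int[uniform_prob (@ltr01 R)]_u
    uniform_cube k (sqball x (t - (a - u) ^+ 2)%R)).
  rewrite {1}/uniform_cube /= /distribution /pushforward /= /product_measure1 /=.
  apply: eq_integral => u _; congr (prod_prob _ k _).
  apply/seteqP; split => y; rewrite /xsection/= inE /sqball/= /tuple_cons.
    by rewrite sqdist_cons lerBrDl.
  by rewrite sqdist_cons lerBrDl.
by rewrite integral_uniform ?subr0 ?invr1 ?mul1e//; exact: measurable_cube_slice.
Qed.

Lemma le_ball_vol k t t' : (t <= t')%R -> ball_vol k t <= ball_vol k t'.
Proof.
elim: k t t' => [|k IH] t t' tt'.
  rewrite /= lee_fin; case: (leP 0%R t) => [t0|_]; last by rewrite ler0n.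
  by rewrite (le_trans t0 tt').
rewrite !(ball_vol_center _ _ 0); apply: ge0_le_integral => //=.
- by move=> x _; exact: ball_vol_ge0.
- by apply: measurable_ball_vol_sub_sqr; exact: measurable_funB.
- by apply: measurable_ball_vol_sub_sqr; exact: measurable_funB.
- by move=> x _; apply: IH; rewrite lerD2r.
Qed.

Lemma cube_sqball0 (x : Defs.point R 0) t :
  uniform_cube 0 (sqball x t) = ball_vol 0 t.
Proof.
rewrite /uniform_cube /= /dirac /= indicE; congr ((nat_of_bool _)%:R%:E).
by apply/idP/idP; rewrite inE /sqball /= /sqdist big_ord0.
Qed.

(** The part of a shell inside the cube has at most the volume of the shell. The
    additive form makes sense for extended reals and survives integration of the
    slices. It gives both the upper bound on the mass of a ball and the
    continuity of that mass in the radius. *)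
Lemma cube_sqball_shell k (x : Defs.point R k) t t' : (t <= t')%R ->
  uniform_cube k (sqball x t') + ball_vol k t <=
  uniform_cube k (sqball x t) + ball_vol k t'.
Proof.
elim: k x t t' => [|k IH] x t t' tt'.
  by rewrite !cube_sqball0 addeC.
case/tupleP: x => a x; rewrite !cube_sqballS !(ball_vol_center _ _ a).
pose w s := (fun u : measurableTypeR R =>
  uniform_cube k (sqball x (s - (a - u) ^+ 2))%R) \_ `[0%R, 1%R].
rewrite -/(w t) -/(w t').
have mw s : measurable_fun setT (w s).
  apply/measurable_restrict => //; apply: measurable_funTS.
  exact: measurable_cube_slice.
have mv s : measurable_fun setT
    (fun u : measurableTypeR R => ball_vol k (s - (a - u) ^+ 2)).
  by apply: measurable_ball_vol_sub_sqr; exact: measurable_funB.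
have w0 s u : 0 <= w s u.
  by rewrite /w patchE; case: ifP.
have v0 s u : 0 <= ball_vol k (s - (a - u) ^+ 2).
  exact: ball_vol_ge0.
rewrite -!ge0_integralD//; [|exact: mw|exact: mw].
apply: ge0_le_integral => //.
- by move=> u _; rewrite adde_ge0.
- by apply: emeasurable_funD; [exact: mw|exact: mv].
- by apply: emeasurable_funD; [exact: mw|exact: mv].
move=> u _; rewrite /w !patchE; case: ifP => _.
  by apply: IH; rewrite lerD2r.
by rewrite !add0e le_ball_vol// lerD2r.
Qed.

Lemma cube_sqball_le k (x : Defs.point R k) t :
  uniform_cube k (sqball x t) <= ball_vol k t.
Proof.
have [t0|t0] := leP 0%R t; last first.
  rewrite (_ : sqball x t = set0) ?measure0 ?ball_vol_ge0//.
  apply/seteqP; split => y //=; rewrite /sqball/= leNgt.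
  by rewrite (lt_le_trans t0)// sqdist_ge0.
(* a shell of negative inner squared radius is the whole ball *)
have /(cube_sqball_shell x) : (-1 <= t)%R by rewrite (le_trans _ t0).
rewrite ball_vol_lt0// adde0 => /le_trans; apply.
rewrite (_ : sqball x (-1) = set0) ?measure0 ?add0e//.
apply/seteqP; split => y //=; rewrite /sqball/= leNgt.
by rewrite (@lt_le_trans _ _ 0%R)// sqdist_ge0.
Qed.

(** The hypothesis puts the whole ball inside the cube: where the slicing variable
    leaves the unit interval, the slices of the ball are empty, so confining it
    loses nothing. *)
Lemma cube_sqballE k (x : Defs.point R k) t :
  (forall c, Num.sqrt t <= tnth x c <= 1 - Num.sqrt t)%R ->
  uniform_cube k (sqball x t) = ball_vol k t.
Proof.
elim: k x t => [|k IH] x t xt.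
  exact: cube_sqball0.
case/tupleP: x xt => a x xt.
have at_ : (Num.sqrt t <= a <= 1 - Num.sqrt t)%R by have := xt ord0; rewrite tnth0.
rewrite cube_sqballS (ball_vol_center _ _ a).
apply: eq_integral => u _; rewrite patchE mem_setE in_itv/=; case: ifPn => [_|u01].
  apply: IH => c; have := xt (lift ord0 c); rewrite tnthS => /andP[tc ct].
  have st : (Num.sqrt (t - (a - u) ^+ 2) <= Num.sqrt t)%R.
    by rewrite ler_wsqrtr// lerBlDr lerDl sqr_ge0.
  by rewrite (le_trans st tc) (le_trans ct)// lerD2l lerN2.
rewrite ball_vol_lt0// subr_lt0.
have tau : (Num.sqrt t < `|a - u|)%R.
  rewrite ltr_normr; move: u01; rewrite negb_and -!ltNge => /orP[]; lra.
have [t0|t0] := leP 0%R t; last by rewrite (lt_le_trans t0)// sqr_ge0.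
rewrite -(sqr_sqrtr t0) -[X in (_ < X)%R]real_normK ?num_real//.
by rewrite ltr_pXn2r ?nnegrE ?sqrtr_ge0.
Qed.

End CubeBalls.

(** * Independent samples *)

Section ProductLaw.
Context d (T : measurableType d) (R : realType) (P : probability T R).
Local Open Scope ereal_scope.

Lemma measurable_tuple_box n (A : 'I_n -> set T) :
  (forall i, measurable (A i)) ->
  measurable [set t : n.-tuple T | forall i, A i (tnth t i)].
Proof.
move=> mA.
rewrite (_ : [set t | _] = \bigcap_(i in [set: 'I_n]) ((@tnth n T)^~ i @^-1` A i)).
  apply: fin_bigcap_measurable => [|i _]; first exact: finite_finset.
  by rewrite -[X in measurable X]setTI; exact: (measurable_tnth i measurableT (mA i)).
by apply/seteqP; split => t /= At i; [move=> _|]; exact: At.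
Qed.

(** Independence of the coordinates under [prod_prob]. *)
Lemma prod_prob_box n (A : 'I_n -> set T) : (forall i, measurable (A i)) ->
  prod_prob P n [set t | forall i, A i (tnth t i)] = \prod_(i < n) P (A i).
Proof.
elim: n A => [|n IH] A mA.
  by rewrite big_ord0 /= /dirac indicE mem_set// => -[].
rewrite big_ord_recl -IH; last by move=> i; exact: mA.
transitivity ((P \x prod_prob P n)
    (A ord0 `*` [set t | forall i, A (lift ord0 i) (tnth t i)])); last first.
  rewrite /= product_measure1E//.
  exact: (@measurable_tuple_box _ (fun i => A (lift ord0 i))).
rewrite /= /distribution /pushforward /=.
congr (product_measure1 _ _ _); apply/seteqP; split => -[x t] /=.
  move=> At; split => [|i] /=; first by have := At ord0; rewrite tnth0.
  by have := At (lift ord0 i); rewrite tnthS.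
move=> [/= A0 At] i; case: (unliftP ord0 i) => [j|] ->; first by rewrite tnthS.
by rewrite tnth0.
Qed.

Lemma prod_prob_tnth n (i : 'I_n) (A : set T) : measurable A ->
  prod_prob P n [set t | A (tnth t i)] = P A.
Proof.
move=> mA; have := @prod_prob_box n (fun j => if j == i then A else setT).
rewrite (bigD1 i)//= eqxx big1 ?mule1; last first.
  by move=> j /negbTE ->; rewrite probability_setT.
move=> <-; last by move=> j; case: ifP.
congr (prod_prob P n _); apply/seteqP; split => t /=.
  by move=> At j; case: eqP => [->|].
by move=> /(_ i); rewrite eqxx.
Qed.

Lemma prod_prob_tnth2 n (i j : 'I_n) (A B : set T) : i != j ->
  measurable A -> measurable B ->
  prod_prob P n [set t | A (tnth t i) /\ B (tnth t j)] = P A * P B.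
Proof.
move=> ij mA mB.
have := @prod_prob_box n (fun l => if l == i then A else if l == j then B else setT).
rewrite (bigD1 i)//= (bigD1 j) 1?eq_sym//= eqxx eq_sym (negbTE ij) eqxx.
rewrite big1 ?mule1; last first.
  by move=> l /andP[/negbTE -> /negbTE ->]; rewrite probability_setT.
move=> <-; last by move=> l; case: ifP => // _; case: ifP.
congr (prod_prob P n _); apply/seteqP; split => t /=.
  by move=> [At Bt] l; case: eqP => [->//|_]; case: eqP => [->//|].
move=> H; split; first by have := H i; rewrite eqxx.
by have := H j; rewrite eq_sym (negbTE ij) eqxx.
Qed.

Lemma prod_prob_all n (A : set T) (p : R) : measurable A -> P A = p%:E ->
  prod_prob P n [set t | forall i, A (tnth t i)] = (p ^+ n)%:E.
Proof.
move=> mA PA; rewrite (prod_prob_box (fun _ => mA)).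
by elim: n => [|n IH]; rewrite ?big_ord0// big_ord_recl IH PA exprS EFinM.
Qed.

End ProductLaw.

Section ProductBounds.
Context d1 d2 (T1 : measurableType d1) (T2 : measurableType d2) (R : realType).
Variables (P : probability T1 R) (Q : probability T2 R).
Local Open Scope ereal_scope.
Implicit Type (E : set (T1 * T2)) (c : R).

Lemma product_le_xsection E c : measurable E ->
  (forall x, Q (xsection E x) <= c%:E) -> (P \x Q) E <= c%:E.
Proof.
move=> mE Ec; rewrite /= /product_measure1 /=.
apply: (@le_trans _ _ (\int[P]_x cst c%:E x)).
  apply: ge0_le_integral => //=.
  exact: measurable_fun_xsection.
by rewrite integral_cst//= probability_setT mule1.
Qed.

Lemma product_ysectionE E : measurable E ->
  (P \x Q) E = \int[Q]_y P (ysection E y).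
Proof.
move=> mE; have := indic_fubini_tonelli P Q mE.
by rewrite indic_fubini_tonelli_FE// indic_fubini_tonelli_GE.
Qed.

Lemma product_le_ysection E c : measurable E ->
  (forall y, P (ysection E y) <= c%:E) -> (P \x Q) E <= c%:E.
Proof.
move=> mE Ec; rewrite product_ysectionE//.
apply: (@le_trans _ _ (\int[Q]_x cst c%:E x)).
  apply: ge0_le_integral => //=.
  exact: measurable_fun_ysection.
by rewrite integral_cst//= probability_setT mule1.
Qed.

Lemma product_ge_xsection E (A : set T1) c : measurable E -> measurable A ->
  (0 <= c)%R -> (forall x, A x -> c%:E <= Q (xsection E x)) ->
  c%:E * P A <= (P \x Q) E.
Proof.
move=> mE mA c0 Ec; rewrite /= /product_measure1 /=.
rewrite -(setIT A) -integral_indic// -ge0_integralZl//; last first.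
  exact/measurable_EFinP/measurable_indic.
apply: ge0_le_integral => //=.
- by move=> x _; rewrite -EFinM lee_fin mulr_ge0.
- apply/measurable_EFinP; apply: measurable_funM => //; exact: measurable_indic.
- exact: measurable_fun_xsection.
move=> x _; rewrite indicE; case: (boolP (x \in A)) => [/set_mem Ax|_].
  by rewrite mule1 Ec.
by rewrite mule0.
Qed.

End ProductBounds.

(** * Deterministic bounds on the matching number *)

Section MatchingBounds.
Local Close Scope classical_set_scope.
Context {S D : finType}.
Implicit Types (e : S -> D -> bool) (M : {set S * D}).

Lemma is_matching_size e M : is_matching e M -> (#|M| <= matching_number e)%N.
Proof. by move=> eM; exact: (@leq_bigmax_cond _ (is_matching e) (fun M => #|M|)). Qed.

Lemma is_matchingP e M : reflect
  ((forall p, p \in M -> e p.1 p.2) /\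
   {in M &, forall p q, p != q -> p.1 != q.1 /\ p.2 != q.2}) (is_matching e M).
Proof.
apply: (iffP andP) => -[eM dM]; split.
- by move=> p pM; exact: (forall_inP eM).
- move=> p q pM qM pq; have /forall_inP/(_ _ qM)/implyP/(_ pq)/andP := forall_inP dM _ pM.
  exact.
- exact/forall_inP.
- apply/forall_inP => p pM; apply/forall_inP => q qM; apply/implyP => pq.
  exact/andP/dM.
Qed.

(** The first projection is injective on a matching. *)
Lemma matching_number_le_deg e :
  (matching_number e <= \sum_i [exists j, e i j])%N.
Proof.
apply/bigmax_leqP => M /is_matchingP[eM dM].
have <- : #|fst @: M| = #|M|.
  apply: card_in_imset => p q pM qM pq; apply/eqP; apply: contraT => /(dM _ _ pM qM)[].
  by rewrite pq eqxx.
rewrite -sum1_card big_mkcond/=; apply: leq_sum => i _.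
case: ifPn => // /imsetP[p pM ->].
by rewrite lt0b; apply/existsP; exists p.2; exact: eM.
Qed.

(** Deleting from a matching of [e'] the edges missing from [e] leaves a matching
    of [e]. *)
Lemma matching_number_le_sub e e' :
  (matching_number e' <= matching_number e + \sum_p (e' p.1 p.2 && ~~ e p.1 p.2))%N.
Proof.
apply/bigmax_leqP => M /is_matchingP[eM dM].
rewrite -(cardsID [set p | e p.1 p.2] M) leq_add//.
  apply: is_matching_size; apply/is_matchingP; split.
    by move=> p; rewrite !inE => /andP[].
  by move=> p q; rewrite !inE => /andP[pM _] /andP[qM _]; exact: dM.
rewrite -sum1_card big_mkcond/=; apply: leq_sum => p _.
by rewrite !inE; case: ifPn => // /andP[ep pM]; rewrite eM// ep.
Qed.

End MatchingBounds.

Section ContentionBound.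
Local Close Scope classical_set_scope.

(** Let every non-isolated node of [A] choose a neighbour, except those that share
    a neighbour with an earlier node of [A]: the choices of the others do not
    collide and form a matching, and each exception is charged to a contending
    pair. *)
Lemma deg_le_matching_number n (D : finType) (A : {set 'I_n}) (e : 'I_n -> D -> bool) :
  (\sum_(i in A) [exists j, e i j] <=
   matching_number e +
   \sum_(p : 'I_n * 'I_n | [&& p.1 \in A, p.2 \in A & (p.1 < p.2)%N])
     [exists j, e p.1 j && e p.2 j])%N.
Proof.
pose share i i' := [exists j, e i j && e i' j].
pose B := [set i in A | [exists j, e i j] &&
  [forall i' : 'I_n, (i' \in A) && (i' < i)%N ==> ~~ share i' i]].
pose M := [set p : 'I_n * D | (p.1 \in B) && ([pick j | e p.1 j] == Some p.2)].
have MB : (#|B| <= #|M|)%N.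
  apply: leq_trans (leq_imset_card fst M); apply/subset_leq_card/fintype.subsetP => i iB.
  have /existsP[j0 ej0] : [exists j, e i j] by move: iB; rewrite inE => /and3P[].
  case pj : [pick j | e i j] => [j|]; last first.
    by move: pj; case: pickP => // /(_ j0); rewrite ej0.
  by apply/imsetP; exists (i, j) => //; rewrite inE/= iB pj eqxx.
have mM : is_matching e M.
  have eM p : p \in M -> e p.1 p.2.
    by rewrite inE => /andP[_]; case: pickP => // j ej /eqP[<-].
  apply/is_matchingP; split => // p q pM qM pq; apply/andP.
  rewrite -negb_or; apply: contraNN pq => /orP[]/eqP pq.
    move: pM qM; rewrite !inE => /andP[_ /eqP Ep] /andP[_ /eqP Eq].
    case: p q pq Ep Eq => [p1 p2] [q1 q2] /= -> -> [->]; exact: eqxx.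
  have disj i i' : i \in B -> i' \in B -> share i i' -> ~~ (i < i')%N.
    rewrite !inE => /andP[iA _] /and3P[_ _ /forallP/(_ i)] + sii.
    by rewrite iA/= sii implybF.
  have [pB qB] : p.1 \in B /\ q.1 \in B.
    by move: pM qM; rewrite !inE => /andP[-> _] /andP[-> _].
  have s1 : share p.1 q.1 by apply/existsP; exists p.2; rewrite eM//= pq eM.
  have s2 : share q.1 p.1 by apply/existsP; exists p.2; rewrite eM//= pq eM.
  have p1q1 : p.1 = q.1.
    by apply/val_inj/eqP; rewrite eqn_leq leqNgt disj//= leqNgt disj.
  by case: p q p1q1 pq {pM qM pB qB s1 s2} => [p1 p2] [q1 q2] /= -> ->.
apply: (@leq_trans (#|B| + \sum_(p : 'I_n * 'I_n |
    [&& p.1 \in A, p.2 \in A & (p.1 < p.2)%N]) share p.1 p.2)); last first.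
  by rewrite leq_add2r (leq_trans MB)// is_matching_size.
set PP := [set p : 'I_n * 'I_n |
  [&& p.1 \in A, p.2 \in A & (p.1 < p.2)%N] && share p.1 p.2].
have -> : (\sum_(p : 'I_n * 'I_n | [&& p.1 \in A, p.2 \in A & (p.1 < p.2)%N])
    share p.1 p.2 = #|PP|)%N.
  by rewrite -sum1dep_card [RHS]big_mkcondr/=; apply: eq_bigr => p _; case: (share _ _).
have -> : (\sum_(i in A) [exists j, e i j] = #|[set i in A | [exists j, e i j]]|)%N.
  by rewrite -sum1dep_card [RHS]big_mkcondr/=; apply: eq_bigr => p _; case: [exists _, _].
apply: (@leq_trans (#|B| + #|snd @: PP|)); last first.
  by rewrite leq_add2l leq_imset_card.
rewrite (leq_trans _ (leq_card_setU _ _))//; apply/subset_leq_card/fintype.subsetP => i.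
rewrite !inE => /andP[iA ei]; rewrite iA ei/=.
case: (boolP [forall i' : 'I_n, _]) => //=; rewrite negb_forall => /existsP[i'].
rewrite negb_imply negbK => /andP[/andP[i'A i'i] sii].
by apply/imsetP; exists (i', i) => //; rewrite inE/= i'A iA i'i.
Qed.

End ContentionBound.

(** * From counting to expectations *)

Section FiniteValued.
Context d (T : measurableType d) (R : realType).

Lemma measurable_fin_comp (X : finType) (phi : T -> X) (g : X -> R) :
  (forall x, measurable (phi @^-1` [set x])) ->
  measurable_fun setT (g \o phi).
Proof.
move=> mphi _ Y mY; rewrite setTI.
rewrite (_ : _ @^-1` Y = \bigcup_(x in [set x | Y (g x)]) (phi @^-1` [set x])).
  exact: fin_bigcup_measurable.
by apply/seteqP; split => [w /= Yw|w [x /= Yx ->]//]; exists (phi w).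
Qed.

Variable P : probability T R.
Local Open Scope ereal_scope.

Definition mean (F : T -> nat) : \bar R := \int[P]_w ((F w)%:R)%:E.

Lemma mean_sum_indic (I : finType) (Q : pred I) (b : I -> T -> bool) :
  (forall i, measurable [set w | b i w]) ->
  mean (fun w => \sum_(i | Q i) b i w)%N = \sum_(i | Q i) P [set w | b i w].
Proof.
move=> mb; rewrite /mean.
rewrite -big_filter.
transitivity (\int[P]_w (\sum_(i <- [seq i <- index_enum I | Q i])
    (\1_[set w | b i w] w)%:E)).
  apply: eq_integral => w _; rewrite natr_sum -sumEFin -big_filter; apply: eq_bigr => i _.
  by rewrite indicE mem_setE.
rewrite ge0_integral_sum//; last first.
  by move=> i; exact/measurable_EFinP/measurable_indic.
by apply: eq_bigr => i _; rewrite integral_indic ?setIT.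
Qed.

Lemma le_mean (F G : T -> nat) :
  measurable_fun setT (fun w => (F w)%:R : R) ->
  measurable_fun setT (fun w => (G w)%:R : R) ->
  (forall w, F w <= G w)%N -> mean F <= mean G.
Proof.
move=> mF mG FG; apply: ge0_le_integral => //.
- exact/measurable_EFinP.
- exact/measurable_EFinP.
- by move=> w _; rewrite lee_fin ler_nat.
Qed.

Lemma meanD (F G : T -> nat) :
  measurable_fun setT (fun w => (F w)%:R : R) ->
  measurable_fun setT (fun w => (G w)%:R : R) ->
  mean (fun w => F w + G w)%N = mean F + mean G.
Proof.
move=> mF mG; rewrite /mean -ge0_integralD//.
- by apply: eq_integral => w _; rewrite natrD.
- exact/measurable_EFinP.
- exact/measurable_EFinP.
Qed.

Lemma measurable_sum_indic (I : finType) (Q : pred I) (b : I -> T -> bool) :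
  (forall i, measurable [set w | b i w]) ->
  measurable_fun setT (fun w => (\sum_(i | Q i) b i w)%N%:R : R).
Proof.
move=> mb; under eq_fun do rewrite natr_sum big_mkcond.
apply: measurable_sum => i; case: (Q i) => //.
rewrite (_ : (fun w => _) = \1_[set w | b i w])//.
by apply/funext => w; rewrite indicE mem_setE.
Qed.

End FiniteValued.

Section ModelMeasurability.
Context {R : realType}.
Variables (k n : nat).
Notation Omega := (n.-tuple (Defs.point R k) * n.-tuple (Defs.point R k))%type.
Implicit Types (r : 'rV[R]_n).

Definition reach r (i : 'I_n) : R := r 0 i * n%:R `^ (- k%:R^-1).

Lemma adjacentE r (w : Omega) i j : 0 <= reach r i ->
  Defs.adjacent r w i j = (sqdist (tnth w.1 i) (tnth w.2 j) <= reach r i ^+ 2).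
Proof.
move=> q0; rewrite /Defs.adjacent /euclidean_dist -/(sqdist _ _) -/(reach r i).
by rewrite -{1}(ger0_norm q0) -sqrtr_sqr ler_sqrt// sqr_ge0.
Qed.

Lemma measurable_adjacent r i j : measurable [set w : Omega | Defs.adjacent r w i j].
Proof.
have [q0|q0] := leP 0 (reach r i).
  rewrite (_ : [set w | _] =
      [set w : Omega | sqdist (tnth w.1 i) (tnth w.2 j) <= reach r i ^+ 2]).
    by apply: measurable_sqdist_le; apply: (measurableT_comp (measurable_tnth _)).
  by apply/seteqP; split => w /=; rewrite adjacentE.
rewrite (_ : [set w | _] = set0)//; apply/seteqP; split => w //=.
by rewrite /Defs.adjacent -/(reach r i) leNgt (lt_le_trans q0)// sqrtr_ge0.
Qed.

Lemma measurable_adjacent_diff r r' i j :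
  measurable [set w : Omega | Defs.adjacent r' w i j && ~~ Defs.adjacent r w i j].
Proof.
have := measurableD (measurable_adjacent r' i j) (measurable_adjacent r i j).
congr measurable; apply/seteqP; split => w /=; first by move=> [-> /negP].
by move=> /andP[-> /negP].
Qed.

Definition adjacency r (w : Omega) : {ffun 'I_n * 'I_n -> bool} :=
  [ffun p => Defs.adjacent r w p.1 p.2].

Lemma measurable_of_adjacency r (g : {ffun 'I_n * 'I_n -> bool} -> R) :
  measurable_fun setT (fun w => g (adjacency r w)).
Proof.
apply: (@measurable_fin_comp _ _ _ _ (adjacency r) g) => h.
rewrite (_ : _ @^-1` _ =
    \bigcap_(p in [set: 'I_n * 'I_n])
      (if h p then [set w : Omega | Defs.adjacent r w p.1 p.2]
            else ~` [set w : Omega | Defs.adjacent r w p.1 p.2])).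
  apply: fin_bigcap_measurable => // p _; case: ifP => _.
    exact: measurable_adjacent.
  by apply: measurableC; exact: measurable_adjacent.
apply/seteqP; split => w /=.
  by move=> <- p _; rewrite ffunE; case: ifPn => //= /negP.
move=> hw; apply/ffunP => p; rewrite ffunE; have := hw p Logic.I.
by case: (h p) => //= /negP/negbTE.
Qed.

Lemma measurable_matching_number r :
  measurable_fun setT (fun w : Omega => (matching_number (Defs.adjacent r w))%:R : R).
Proof.
have := measurable_of_adjacency r (fun h => (matching_number (fun i j => h (i, j)))%:R).
congr measurable_fun; apply/funext => w; congr ((matching_number _)%:R).
by apply/funext => i; apply/funext => j; rewrite ffunE.
Qed.

Lemma measurable_adjacencyP r (g : {ffun 'I_n * 'I_n -> bool} -> bool) :
  measurable [set w : Omega | g (adjacency r w)].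
Proof.
have := measurable_of_adjacency r (fun h => (g h)%:R) measurableT (measurable_set1 1).
rewrite setTI; congr measurable; apply/seteqP; split => w /=; last by move=> ->.
by case: (g _) => // /esym/eqP; rewrite oner_eq0.
Qed.

Definition covered r i : set Omega := [set w | [exists j, Defs.adjacent r w i j]].

Definition contended r i i' : set Omega :=
  [set w | [exists j, Defs.adjacent r w i j && Defs.adjacent r w i' j]].

Lemma measurable_covered r i : measurable (covered r i).
Proof.
have := measurable_adjacencyP r (fun h => [exists j, h (i, j)]).
congr measurable; apply/funext => w; rewrite /covered /=; congr is_true.
by apply: eq_existsb => j; rewrite ffunE.
Qed.

Lemma measurable_contended r i i' : measurable (contended r i i').
Proof.
have := measurable_adjacencyP r (fun h => [exists j, h (i, j) && h (i', j)]).
congr measurable; apply/funext => w; rewrite /contended /=; congr is_true.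
by apply: eq_existsb => j; rewrite !ffunE.
Qed.

Local Open Scope ereal_scope.
Notation L := (location_law k n : probability _ R).
Notation nu r := (fun w : Omega => matching_number (Defs.adjacent r w)).

Lemma mean_matching_le_covered r : mean L (nu r) <= \sum_i L (covered r i).
Proof.
rewrite -(@mean_sum_indic _ _ _ L _ predT
  (fun i (w : Omega) => [exists j, Defs.adjacent r w i j])).
  apply: le_mean.
  - exact: measurable_matching_number.
  - by apply: measurable_sum_indic => i; exact: measurable_covered.
  - by move=> w; exact: matching_number_le_deg.
by move=> i; exact: measurable_covered.
Qed.

Lemma muE r : (mu k r)%:E = mean L (nu r).
Proof.
rewrite /mu unlock fineK// ge0_fin_numE; last first.
  by apply: integral_ge0 => w _; rewrite lee_fin.
apply: (le_lt_trans (mean_matching_le_covered r)).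
apply: (@le_lt_trans _ _ (\sum_(i < n) 1)).
  by apply: lee_sum => i _; rewrite probability_le1//; exact: measurable_covered.
by rewrite sumEFin ltry.
Qed.

Lemma mu_le_covered r : (mu k r)%:E <= \sum_i L (covered r i).
Proof. by rewrite muE mean_matching_le_covered. Qed.

Lemma mu_le_sub r r' : (mu k r')%:E <= (mu k r)%:E +
  \sum_(p : 'I_n * 'I_n)
    L [set w | Defs.adjacent r' w p.1 p.2 && ~~ Defs.adjacent r w p.1 p.2].
Proof.
have mb (p : 'I_n * 'I_n) := measurable_adjacent_diff r r' p.1 p.2.
have mr := measurable_matching_number r.
rewrite !muE.
rewrite -(@mean_sum_indic _ _ _ L _ predT (fun p (w : Omega) =>
  Defs.adjacent r' w p.1 p.2 && ~~ Defs.adjacent r w p.1 p.2))//.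
have ms := @measurable_sum_indic _ _ R _ predT _ mb.
rewrite -meanD//; apply: le_mean.
- exact: measurable_matching_number.
- by under eq_fun do rewrite natrD; exact: measurable_funD.
- by move=> w; exact: matching_number_le_sub.
Qed.

Lemma covered_le_mu r (A : {set 'I_n}) :
  \sum_(i in A) L (covered r i) <= (mu k r)%:E +
  \sum_(p : 'I_n * 'I_n | [&& p.1 \in A, p.2 \in A & (p.1 < p.2)%N])
     L (contended r p.1 p.2).
Proof.
have mc := measurable_covered r.
have md (p : 'I_n * 'I_n) := measurable_contended r p.1 p.2.
have mr := measurable_matching_number r.
rewrite muE -(@mean_sum_indic _ _ _ L _ _
  (fun i (w : Omega) => [exists j, Defs.adjacent r w i j]))//.
rewrite -(@mean_sum_indic _ _ _ L _ _ (fun p (w : Omega) =>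
  [exists j, Defs.adjacent r w p.1 j && Defs.adjacent r w p.2 j]))//.
have ms := @measurable_sum_indic _ _ R _
  (fun p : 'I_n * 'I_n => [&& p.1 \in A, p.2 \in A & (p.1 < p.2)%N]) _ md.
rewrite -meanD//; apply: le_mean.
- exact: measurable_sum_indic.
- by under eq_fun do rewrite natrD; exact: measurable_funD.
- by move=> w; exact: deg_le_matching_number.
Qed.

End ModelMeasurability.

(** * Probabilities of coverage and contention *)

Lemma measurable_cube_box {R : realType} k (a : R) :
  measurable [set x : Defs.point R k | forall c, a <= tnth x c <= 1 - a].
Proof.
have := @measurable_tuple_box _ (measurableTypeR R) k (fun=> `[a, 1 - a]%classic).
by move=> /(_ (fun=> measurable_itv _)); congr measurable.
Qed.

Lemma cube_box {R : realType} k (a : R) : 0 <= a -> a <= 2^-1 ->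
  uniform_cube k [set x | forall c, a <= tnth x c <= 1 - a] = ((1 - 2 * a) ^+ k)%:E.
Proof.
move=> a0 a2.
have -> : [set x : Defs.point R k | forall c, a <= tnth x c <= 1 - a] =
    [set x | forall c, `[a, 1 - a]%classic (tnth x c)].
  by apply/seteqP; split => x /= xa c; have := xa c; rewrite in_itv.
apply: prod_prob_all; first exact: measurable_itv.
rewrite /= /uniform_prob (eq_integral (cst 1%E)); last first.
  move=> x; rewrite inE/= in_itv/= /uniform_pdf => /andP[ax xa].
  by rewrite (le_trans a0 ax) (le_trans xa) ?gerBl// subr0 invr1.
rewrite integral_cst//= mul1e lebesgue_measure_itv/= lte_fin.
case: ltP => [_|aa]; first by rewrite -EFinD; congr (_%:E); ring.
by congr (_%:E); lra.
Qed.

Lemma sqdistC {R : realType} k (x y : Defs.point R k) : sqdist x y = sqdist y x.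
Proof. by apply: eq_bigr => c _; rewrite -sqrrN opprB. Qed.

Section EventProbabilities.
Context {R : realType}.
Variables (k n : nat).
Notation Omega := (n.-tuple (Defs.point R k) * n.-tuple (Defs.point R k))%type.
Implicit Types (r : 'rV[R]_n).
Notation L := (location_law k n : probability _ R).
Notation U := (uniform_cube k : probability _ R).

(** The volume of the service ball of supply node [i], that is, the probability
    that a given demand node lies in it up to the effect of the boundary. *)
Definition ball_mass r i : R := kappa k * reach k r i ^+ k.

Lemma ball_mass_ge0 r i : 0 <= reach k r i -> 0 <= ball_mass r i.
Proof. by move=> q0; rewrite mulr_ge0 ?kappa_ge0 ?exprn_ge0. Qed.

Lemma cube_ball_le r i (x : Defs.point R k) : 0 <= reach k r i ->
  (U (sqball x (reach k r i ^+ 2)) <= (ball_mass r i)%:E)%E.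
Proof. by move=> q0; rewrite -ball_volE// cube_sqball_le. Qed.

(** Once the supply locations are fixed, the demand nodes fall into the service
    ball independently with the same probability. *)
Lemma covered_section r i (s : n.-tuple (Defs.point R k)) : 0 <= reach k r i ->
  prod_prob U n (xsection (covered r i) s) =
  (1 - (1 - fine (U (sqball (tnth s i) (reach k r i ^+ 2)))) ^+ n)%:E.
Proof.
move=> q0; set B := sqball _ _.
have mB : measurable B by exact: measurable_sqball.
have UB : U (~` B) = (1 - fine (U B))%:E.
  by rewrite probability_setC// EFinB fineK// fin_num_measure.
have UBn := prod_prob_all n (measurableC mB) UB.
rewrite EFinB -UBn -probability_setC; last first.
  by apply: (@measurable_tuple_box _ _ n (fun=> ~` B)) => _; exact: measurableC.
congr (prod_prob _ _ _); apply/seteqP; split => d; rewrite /xsection/= inE /covered/=.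
  by move=> /existsP[j]; rewrite adjacentE// => sd /(_ j).
move=> nd; apply/existsP; apply: contra_notP nd => nd j Bd; apply: nd; exists j.
by rewrite adjacentE.
Qed.

Lemma covered_le r i : 0 <= reach k r i ->
  (L (covered r i) <= (1 - (1 - Num.min 1 (ball_mass r i)) ^+ n)%:E)%E.
Proof.
move=> q0; apply: product_le_xsection; first exact: measurable_covered.
move=> s; rewrite covered_section//; set B := sqball _ _.
have UB1 : (fine (U B) <= Num.min 1 (ball_mass r i)).
  rewrite le_min -!lee_fin fineK ?fin_num_measure//; last exact: measurable_sqball.
  by rewrite cube_ball_le// probability_le1//; exact: measurable_sqball.
rewrite lee_fin lerD2l lerN2 lerXn2r ?nnegrE ?subr_ge0 ?lerD2l ?lerN2//.
  by rewrite ge_min lexx.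
by rewrite (le_trans UB1)// ge_min lexx.
Qed.

(** Only locations at distance at least the service radius from the boundary are
    counted: there the service ball lies in the cube. This costs the factor
    [(1 - 2 * reach k r i) ^+ k]. *)
Lemma covered_ge r i : 0 <= reach k r i -> reach k r i <= 2^-1 ->
  (((1 - 2 * reach k r i) ^+ k * (1 - expR (- (n%:R * ball_mass r i))))%:E <=
   L (covered r i))%E.
Proof.
move=> q0 q2.
pose I := [set x : Defs.point R k | forall c, reach k r i <= tnth x c <= 1 - reach k r i].
have mI : measurable I by exact: measurable_cube_box.
have UI (x : Defs.point R k) : I x -> U (sqball x (reach k r i ^+ 2)) = (ball_mass r i)%:E.
  by move=> Ix; rewrite cube_sqballE ?ball_volE// sqrtr_sqr ger0_norm.
have IE : U I = ((1 - 2 * reach k r i) ^+ k)%:E by exact: cube_box.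
have [I0|/set0P[x Ix]] := eqVneq I set0.
  by move: IE; rewrite I0 measure0 => -[<-]; rewrite mul0r.
have qm : 0 <= ball_mass r i <= 1.
  rewrite ball_mass_ge0//= -lee_fin -(UI x Ix) probability_le1//.
  exact: measurable_sqball.
rewrite mulrC EFinM -IE -(prod_prob_tnth U i mI).
apply: product_ge_xsection.
- exact: measurable_covered.
- by have := measurable_tnth i measurableT mI; rewrite setTI.
- by rewrite subr_ge0 expR_le1 oppr_le0 mulr_ge0// ball_mass_ge0.
move=> s sI; rewrite covered_section// UI// lee_fin lerD2l lerN2.
rewrite -[- (n%:R * _)]mulrN expRM_natl.
rewrite lerXn2r ?nnegrE ?expR_ge0 ?subr_ge0//; first by case/andP: qm.
exact: expR_ge1Dx.
Qed.

(** A union bound over the demand nodes [j]; for fixed [d_j] the two supply nodes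
    reach it independently, which makes contention a second-order event. *)
Lemma contended_le r i i' : i != i' -> 0 <= reach k r i -> 0 <= reach k r i' ->
  (L (contended r i i') <= (n%:R * ball_mass r i * ball_mass r i')%:E)%E.
Proof.
move=> ii' q0 q0'.
pose E j := [set w : Omega | Defs.adjacent r w i j /\ Defs.adjacent r w i' j].
have mE j : measurable (E j).
  exact: (measurableI _ _ (measurable_adjacent r i j) (measurable_adjacent r i' j)).
apply: (@le_trans _ _ (\sum_(j \in [set: 'I_n]) L (E j))%E).
  apply: (@content_sub_fsum _ _ _ L _ setT _ E) => [|j _||w /existsP[j /andP[wi wi']]].
  - exact: finite_finset.
  - exact: mE.
  - exact: measurable_contended.
  - by exists j.
have -> : (\sum_(j \in [set: 'I_n]) L (E j) = \sum_(j < n) L (E j))%E.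
  rewrite [RHS]fsbig_seq ?index_enum_uniq//.
  by apply: eq_fsbigl; apply/seteqP; split => j //= _; exact: mem_index_enum.
rewrite -mulrA mulr_natl -[X in _ *+ X](card_ord n) -sumr_const -sumEFin.
apply: lee_sum => j _; apply: product_le_ysection => // d.
pose B := sqball (tnth d j) (reach k r i ^+ 2).
pose B' := sqball (tnth d j) (reach k r i' ^+ 2).
have mB : measurable B by exact: measurable_sqball.
have mB' : measurable B' by exact: measurable_sqball.
rewrite (_ : ysection _ _ = [set s | B (tnth s i) /\ B' (tnth s i')]); last first.
  apply/seteqP; split => s; rewrite /ysection/= inE /E/= !adjacentE//.
    by rewrite !(sqdistC (tnth s _)).
  by rewrite !(sqdistC (tnth s _)).
rewrite (prod_prob_tnth2 U ii' mB mB') EFinM.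
by apply: lee_pmul => //; exact: cube_ball_le.
Qed.

(** The demand node has to fall in the shell between the two service balls. *)
Lemma adjacent_diff_le r r' i j : 0 <= reach k r i -> 0 <= reach k r' i ->
  (L [set w | Defs.adjacent r' w i j && ~~ Defs.adjacent r w i j] <=
   `|ball_mass r' i - ball_mass r i|%:E)%E.
Proof.
move=> q0 q0'.
pose B (s : n.-tuple (Defs.point R k)) := sqball (tnth s i) (reach k r i ^+ 2).
pose B' (s : n.-tuple (Defs.point R k)) := sqball (tnth s i) (reach k r' i ^+ 2).
have mB s : measurable (B s) by exact: measurable_sqball.
have mB' s : measurable (B' s) by exact: measurable_sqball.
apply: product_le_xsection => [|s].
  exact: measurable_adjacent_diff.
rewrite (_ : xsection _ _ = [set d | (B' s `\` B s) (tnth d j)]); last first.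
  apply/seteqP; split => d; rewrite /xsection/= inE /= !adjacentE//.
    by move=> /andP[? /negP].
  by move=> [? /negP ?]; apply/andP.
rewrite (prod_prob_tnth U j (measurableD (mB' s) (mB s))).
have [rr'|r'r] := leP (reach k r i) (reach k r' i); last first.
  rewrite (_ : B' s `\` B s = set0) ?measure0//.
  rewrite setD_eq0 /B /B' /sqball => y /= /le_trans; apply.
  by rewrite ler_pXn2r ?nnegrE// ltW.
have rr2 : reach k r i ^+ 2 <= reach k r' i ^+ 2 by rewrite ler_pXn2r ?nnegrE.
have BB' : B s `<=` B' s by move=> y /= /le_trans; apply.
have -> : U (B' s `\` B s) = (U (B' s) - U (B s))%E.
  rewrite measureD// ?(setIidr BB')//.
  by rewrite (le_lt_trans (probability_le1 _ _)) ?ltry.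
have : (U (B' s) + ball_vol k (reach k r i ^+ 2) <=
    U (B s) + ball_vol k (reach k r' i ^+ 2))%E.
  exact: cube_sqball_shell.
have fin C : measurable C -> U C = (fine (U C))%:E.
  by move=> mC; rewrite fineK ?fin_num_measure.
rewrite (fin _ (mB s)) (fin _ (mB' s)) !ball_volE// -!EFinD !lee_fin => H.
rewrite (le_trans _ (ler_norm _))//; move: H.
by rewrite -/(ball_mass r i) -/(ball_mass r' i); lra.
Qed.

End EventProbabilities.

(** * Elementary inequalities *)

Section RealBounds.
Context {R : realType}.

Lemma bernoulli (v : R) n : 0 <= v <= 1 -> 1 - n%:R * v <= (1 - v) ^+ n.
Proof.
move=> /andP[v0 v1]; elim: n => [|n IH]; first by rewrite mul0r subr0 expr0.
have [Hn|Hn] := leP 0 (1 - n%:R * v); last first.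
  rewrite (@le_trans _ _ 0) ?exprn_ge0 ?subr_ge0//.
  by rewrite mulrS; nra.
rewrite exprS; apply: (@le_trans _ _ ((1 - v) * (1 - n%:R * v))).
  by rewrite -natr1; have : (0 : R) <= n%:R by []; nra.
by rewrite ler_wpM2l// subr_ge0.
Qed.

(** Binomial against Poisson coverage. With [u = x / n], one has
    [1 - u >= expR (- u) * (1 - u ^+ 2)], and Bernoulli's inequality gives
    [(1 - u) ^+ n >= expR (- x) * (1 - x ^+ 2 / n)]. The error
    [x ^+ 2 * expR (- x) / n] is at most [2 / n * (1 - expR (- x))] because
    [1 + x ^+ 2 / 2 <= expR x]; so the bound is multiplicative, uniformly in [x]. *)
Lemma coverage_le_exp n (x : R) : (0 < n)%N -> 0 <= x ->
  1 - (1 - Num.min 1 (x / n%:R)) ^+ n <= (1 + 2 / n%:R) * (1 - expR (- x)).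
Proof.
move=> n0; have nR : (0 : R) < n%:R by rewrite ltr0n.
(* beyond x = n the left side is constant and the right side increases *)
wlog xn : x / x <= n%:R => [H|] x0.
  have [xn|/ltW nx] := leP x n%:R; first exact: H.
  have /le_trans := H n%:R (lexx _) (ltW nR).
  rewrite divff ?gt_eqF// minxx (min_idPl _); last by rewrite ler_pdivlMr// mul1r.
  apply; rewrite ler_wpM2l ?addr_ge0 ?divr_ge0//.
  by rewrite lerD2l lerN2 ler_expR lerN2.
rewrite (min_idPr _); last by rewrite ler_pdivrMr// mul1r.
set u := x / n%:R.
have u0 : 0 <= u by rewrite divr_ge0.
have u1 : u <= 1 by rewrite ler_pdivrMr// mul1r.
have xE : x = n%:R * u by rewrite mulrC divfK ?gt_eqF.
have eu : expR (- u) * (1 + u) <= 1.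
  rewrite expRN mulrC ler_pdivrMr ?expR_gt0// mul1r; exact: expR_ge1Dx.
have e0 := expR_gt0 (- u).
have H1 : expR (- u) * (1 - u ^+ 2) <= 1 - u by rewrite expr2; nra.
have u2 : 0 <= u ^+ 2 <= 1 by rewrite exprn_ge0// exprn_ile1.
have H2 : expR (- x) * (1 - n%:R * u ^+ 2) <= (1 - u) ^+ n.
  apply: (@le_trans _ _ (expR (- x) * (1 - u ^+ 2) ^+ n)).
    by rewrite ler_wpM2l ?expR_ge0// bernoulli.
  rewrite xE -mulrN expRM_natl -exprMn lerXn2r ?nnegrE ?subr_ge0//.
  by case/andP: u2 => u20 u21; rewrite mulr_ge0 ?expR_ge0// subr_ge0.
have H3 : x ^+ 2 * expR (- x) <= 2 * (1 - expR (- x)).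
  have := expR_ge1Dxn 1 x0.
  rewrite expRN => H; have E0 := expR_gt0 x.
  rewrite ler_pdivrMr// mulrBr mulr1 mulrBl -mulrA mulVf ?gt_eqF// mulr1.
  move: H; rewrite (_ : 2`! = 2)//; lra.
have H4 : expR (- x) * (n%:R * u ^+ 2) <= 2 / n%:R * (1 - expR (- x)).
  rewrite (_ : _ * _ = (x ^+ 2 * expR (- x)) / n%:R); last first.
    by rewrite xE; field; rewrite gt_eqF.
  by rewrite [leRHS]mulrAC ler_pM2r ?invr_gt0.
lra.
Qed.

Lemma onem_expRN_le (x : R) : 1 - expR (- x) <= x.
Proof. by have := expR_ge1Dx (- x); lra. Qed.

Lemma onem_expRN_ge (x : R) : 0 <= x -> x / (1 + x) <= 1 - expR (- x).
Proof.
move=> x0; have x1 : 0 < 1 + x by lra.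
have : expR (- x) <= (1 + x)^-1.
  by rewrite expRN lef_pV2 ?posrE ?expR_gt0//; exact: expR_ge1Dx.
rewrite (_ : x / (1 + x) = 1 - (1 + x)^-1); last by field; rewrite gt_eqF.
lra.
Qed.

Lemma gk_ge0 k (r : R) : 0 <= r -> 0 <= gk k r.
Proof.
by move=> r0; rewrite subr_ge0 expR_le1 oppr_le0 mulr_ge0 ?kappa_ge0 ?exprn_ge0.
Qed.

Lemma gk0 k : (0 < k)%N -> gk k 0 = 0 :> R.
Proof. by move=> k0; rewrite /gk expr0n gtn_eqF// mulr0 oppr0 expR0 subrr. Qed.

Lemma gk_le k (r : R) : gk k r <= kappa k * r ^+ k.
Proof. exact: onem_expRN_le. Qed.

Lemma gk_le_ratio k (c r : R) : (0 < k)%N -> ubound (ratios k) c -> 0 <= r ->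
  gk k r <= c * r.
Proof.
move=> k0 uc; rewrite le_eqVlt => /predU1P[<-|r0]; first by rewrite gk0// mulr0.
by rewrite -ler_pdivrMr//; apply: uc; exists r.
Qed.

End RealBounds.

(** * Bounds on the expected matching size *)

Section MuBounds.
Context {R : realType}.
Variables (k n : nat).
Hypotheses (k_gt0 : (0 < k)%N) (n_gt0 : (0 < n)%N).
Implicit Types (r : 'rV[R]_n).

Let nR : (0 : R) < n%:R. Proof. by rewrite ltr0n. Qed.

Lemma reach_ge0 r i : 0 <= r 0 i -> 0 <= reach k r i.
Proof. by move=> r0; rewrite mulr_ge0 ?powR_ge0. Qed.

Lemma ball_massE r i : ball_mass k r i = kappa k * r 0 i ^+ k / n%:R.
Proof.
rewrite /ball_mass /reach exprMn -mulrA; congr (_ * (_ * _)).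
rewrite -powR_mulrn ?powR_ge0// -powRrM mulNr mulVf ?pnatr_eq0 -?lt0n//.
by rewrite powR_inv1// ltW.
Qed.

Lemma mu_le_gk r : (forall i, 0 <= r 0 i) ->
  mu k r <= (1 + 2 / n%:R) * \sum_i gk k (r 0 i).
Proof.
move=> r0; rewrite -lee_fin; apply: (le_trans (mu_le_covered k r)).
rewrite mulr_sumr -sumEFin; apply: lee_sum => i _.
apply: (le_trans (covered_le (reach_ge0 (r0 i)))).
rewrite lee_fin ball_massE; apply: coverage_le_exp => //.
by rewrite mulr_ge0 ?kappa_ge0 ?exprn_ge0.
Qed.

(** The linear budget bound: every unit of radius buys at most [c] expected
    matches, up to the factor [1 + 2 / n]. *)
Lemma mu_le_ratio (c : R) r : ubound (ratios k) c -> (forall i, 0 <= r 0 i) ->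
  mu k r <= (1 + 2 / n%:R) * (c * \sum_i r 0 i).
Proof.
move=> uc r0; apply: (le_trans (mu_le_gk r0)).
rewrite ler_wpM2l ?addr_ge0 ?divr_ge0// mulr_sumr.
by apply: ler_sum => i _; exact: gk_le_ratio.
Qed.

(** The first term bounds from below the expected number of covered nodes of [A],
    the second from above the expected number of contending pairs. *)
Lemma mu_ge r (A : {set 'I_n}) (a : R) : 0 <= a ->
  (forall i, i \in A -> r 0 i = a) -> a * n%:R `^ (- k%:R^-1) <= 2^-1 ->
  #|A|%:R * ((1 - 2 * (a * n%:R `^ (- k%:R^-1))) ^+ k * gk k a) -
    #|A|%:R ^+ 2 * (kappa k * a ^+ k) ^+ 2 / n%:R <= mu k r.
Proof.
move=> a0 rA a2; set rho := a * _.
have reachE i : i \in A -> reach k r i = rho by move=> iA; rewrite /reach rA.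
have massE i : i \in A -> ball_mass k r i = kappa k * a ^+ k / n%:R.
  by move=> iA; rewrite ball_massE rA.
have reach0 i : i \in A -> 0 <= reach k r i.
  by move=> iA; rewrite reach_ge0// rA.
rewrite lerBlDr -lee_fin EFinD.
apply: (@le_trans _ _ (\sum_(i in A) location_law k n (covered r i))%E).
  rewrite mulr_natl -sumr_const -sumEFin; apply: lee_sum => i iA.
  apply: le_trans (covered_ge (reach0 _ iA) _); last by rewrite reachE.
  by rewrite lee_fin massE// reachE// [n%:R * _]mulrC divfK ?gt_eqF.
apply: (le_trans (covered_le_mu k r A)); rewrite leeD2l//.
pose c : R := (kappa k * a ^+ k) ^+ 2 / n%:R.
apply: (@le_trans _ _ (\sum_(p : 'I_n * 'I_n |
    [&& p.1 \in A, p.2 \in A & (p.1 < p.2)%N]) c%:E)%E).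
  apply: lee_sum => p /and3P[p1 p2 p12].
  apply: (le_trans (contended_le _ (reach0 _ p1) (reach0 _ p2))).
    by rewrite -val_eqE/= ltn_eqF.
  rewrite !massE// lee_fin le_eqVlt; apply/orP; left; apply/eqP.
  by rewrite /c; field; rewrite gt_eqF.
rewrite sumEFin lee_fin sumr_const -[leLHS]mulr_natl -[leRHS]mulrA -/c ler_wpM2r//.
  by rewrite divr_ge0// sqr_ge0.
rewrite -natrX ler_nat -mulnn -cardsX subset_leq_card//.
by apply/fintype.subsetP => p; rewrite inE => /and3P[-> ->].
Qed.

End MuBounds.

(** * The optimum is attained *)

Lemma set_maxE {R : realType} (A : set R) x : A x -> ubound A x -> set_max A = x.
Proof.
move=> Ax ux; apply: xget_unique => // y [Ay uy].
by apply/le_anti; rewrite ux//= uy.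
Qed.

Section Attained.
Context {R : realType}.
Variables (k n : nat) (b : R).
Hypotheses (k_gt0 : (0 < k)%N) (n_gt0 : (0 < n)%N) (b_ge0 : 0 <= b).

Definition allocations : set 'rV[R]_n :=
  [set r : 'rV[R]_n | (forall i, 0 <= r 0 i) /\ \sum_i r 0 i = n%:R * b].

(** Two allocations differ in an edge only when a demand node falls in one of the
    shells between the service balls, so the expected matching size is continuous
    in the radii. *)
Lemma mu_dist (r r' : 'rV[R]_n) : (forall i, 0 <= r 0 i) -> (forall i, 0 <= r' 0 i) ->
  `|mu k r - mu k r'| <=
    \sum_(p : 'I_n * 'I_n) `|ball_mass k r p.1 - ball_mass k r' p.1|.
Proof.
move=> r0 r'0.
have half (s s' : 'rV[R]_n) : (forall i, 0 <= s 0 i) -> (forall i, 0 <= s' 0 i) ->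
    mu k s - mu k s' <= \sum_(p : 'I_n * 'I_n) `|ball_mass k s p.1 - ball_mass k s' p.1|.
  move=> s0 s'0; rewrite lerBlDl -lee_fin EFinD.
  apply: (le_trans (mu_le_sub k s' s)); rewrite leeD2l// -sumEFin.
  by apply: lee_sum => p _; apply: adjacent_diff_le; exact: reach_ge0.
rewrite ler_norml half// andbT lerNl opprB.
by rewrite (le_trans (half r' r r'0 r0))//; apply: ler_sum => p _; rewrite distrC.
Qed.

Lemma continuous_ball_mass i : continuous (fun r : 'rV[R]_n => ball_mass k r i).
Proof.
have -> : (fun r : 'rV[R]_n => ball_mass k r i) = (fun r => kappa k * r 0 i ^+ k / n%:R).
  by apply/funext => r; exact: ball_massE.
move=> r.
have ck : (fun r' : 'rV[R]_n => r' 0 i ^+ k) @ r --> r 0 i ^+ k.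
  apply: (@continuous_comp _ _ _ (fun r : 'rV[R]_n => r 0 i) (fun x => x ^+ k)).
    exact: coord_continuous.
  exact: exprn_continuous.
exact: (cvgMr_tmp (cvgMl_tmp ck)).
Qed.

Lemma within_continuous_mu : {within allocations, continuous (@mu R k n)}.
Proof.
apply/subspace_continuousP => r [r0 _].
have h0 : (fun r' : 'rV[R]_n => \sum_(p : 'I_n * 'I_n)
    `|ball_mass k r p.1 - ball_mass k r' p.1|) @ r --> (0 : R).
  rewrite [X in _ --> X](_ : _ =
      \sum_(p : 'I_n * 'I_n) `|ball_mass k r p.1 - ball_mass k r p.1|).
    have cp (p : 'I_n * 'I_n) :
        (fun r' : 'rV[R]_n => `|ball_mass k r p.1 - ball_mass k r' p.1|) @ r -->
          `|ball_mass k r p.1 - ball_mass k r p.1|.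
      exact: cvg_norm (cvgB (cvg_cst _) (@continuous_ball_mass p.1 r)).
    apply: (@cvg_big _ _ _ _ _ _ _ (nbhs r)); first exact: add_continuous.
    by move=> p _; exact: cp.
  by rewrite big1// => p _; rewrite subrr normr0.
apply/cvgrPdist_le => e e0.
move/cvgrPdist_le : h0 => /(_ e e0) h0.
near=> r'.
have [r'0 _] : allocations r' by near: r'; exact: withinT.
apply: (le_trans (mu_dist r0 r'0)).
have : `|0 - \sum_(p : 'I_n * 'I_n) `|ball_mass k r p.1 - ball_mass k r' p.1| | <= e.
  by near: r'; exact: cvg_within.
by apply: le_trans; rewrite sub0r normrN ler_norm.
Unshelve. all: by end_near. Qed.

Lemma compact_allocations : compact allocations.
Proof.
pose box := [set r : 'rV[R]_n | forall i, `[0, n%:R * b]%classic (r 0 i)].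
apply: (@subclosed_compact _ _ box).
- rewrite (_ : allocations = \bigcap_(i in [set: 'I_n]) [set r : 'rV[R]_n | 0 <= r 0 i]
     `&` [set r : 'rV[R]_n | \sum_i r 0 i = n%:R * b]); last first.
    by apply/seteqP; split => r [r0 rb]; split => // i; [move=> _|]; exact: r0.
  apply: closedI; first apply: closed_bigI => i _.
    apply: (@preimage_closed _ _ (fun r : 'rV[R]_n => r 0 i) [set x | 0 <= x]).
      by move=> r _; exact: coord_continuous.
    exact: closed_ge.
  apply: (@preimage_closed _ _ (fun r : 'rV[R]_n => \sum_i r 0 i) [set x | x = n%:R * b]).
    move=> r _; apply: (@cvg_big _ _ _ _ _ _ _ (nbhs r)); first exact: add_continuous.
    by move=> i _; exact: coord_continuous.
  exact: closed_eq.
- exact: (@rV_compact _ n (fun=> `[0, n%:R * b]%classic) (fun=> @segment_compact _ _ _)).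
- move=> r [r0 rb] i /=; rewrite in_itv/= r0/= -rb (bigD1 i)//= lerDl.
  by apply: sumr_ge0 => j _.
Qed.

Lemma OPT_attained : exists r, [/\ allocations r, OPT k n b = mu k r &
  forall r', allocations r' -> mu k r' <= OPT k n b].
Proof.
have S0 : allocations !=set0.
  exists (const_mx b); split => [i|]; first by rewrite mxE.
  under eq_bigr do rewrite mxE; by rewrite sumr_const card_ord mulr_natl.
have [r rS rmax] := EVT_max_rV S0 compact_allocations within_continuous_mu.
rewrite inE in rS.
have OE : OPT k n b = mu k r.
  apply: set_maxE; first by exists r.
  by move=> _ [r' r'S <-]; apply: rmax; rewrite inE.
by exists r; split => // r' r'S; rewrite OE rmax// inE.
Qed.

End Attained.

(** * The best ratio of coverage to radius *)

Section RatioMax.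
Context {R : realType}.

Lemma ratios_le_kappa1 : ubound (ratios 1 : set R) (kappa 1).
Proof.
by move=> _ [r /= r0 <-]; rewrite ler_pdivrMr//; have := gk_le 1 r; rewrite expr1.
Qed.

(** In dimension one the ratio decreases in the radius, so its supremum is the
    slope of [gk 1] at 0. *)
Lemma Ck1 : Ck 1 = kappa 1 :> R.
Proof.
rewrite /Ck/=.
have R0 : (ratios 1 : set R) !=set0 by exists (gk 1 1 / 1), 1 => //=.
apply/le_anti/andP; split.
  by apply: ge_sup => //; exact: ratios_le_kappa1.
set C := sup _.
have H (r : R) : 0 < r -> kappa 1 <= C * (1 + kappa 1 * r).
  move=> r0.
  have kr : 0 < 1 + kappa 1 * r by rewrite ltr_wpDr// mulr_ge0 ?kappa_ge0// ltW.
  rewrite -ler_pdivrMr//.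
  apply: (@le_trans _ _ (gk 1 r / r)).
    rewrite ler_pdivlMr// mulrAC -[in leRHS](expr1 r).
    have := @onem_expRN_ge R (kappa 1 * r); rewrite /gk expr1; apply.
    by rewrite mulr_ge0 ?kappa_ge0// ltW.
  apply: ub_le_sup; last by exists r.
  by exists (kappa 1); exact: ratios_le_kappa1.
have K0 : 0 < kappa 1 :> R := kappa_gt0 1.
have C0 : 0 < C.
  by have := H 1 ltr01; nra.
rewrite leNgt; apply/negP => CK.
(* this radius makes the right side of H the midpoint of C and kappa 1 *)
have d0 : 0 < (kappa 1 - C) / (2 * C * kappa 1) 
  by apply: divr_gt0; [rewrite subr_gt0|apply: mulr_gt0 => //; apply: mulr_gt0].
have := H _ d0; rewrite (_ : C * _ = C + (kappa 1 - C) / 2); last by field; rewrite !gt_eqF.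
lra.
Qed.

(** For k >= 2 the ratio is at most [kappa k * r] on the unit interval and at most
    [1 / r] everywhere. So outside a compact interval it is at most its
    value [v] at 1, and on that interval it has a maximum. *)
Lemma ratio_max k : (2 <= k)%N ->
  exists r : R, 0 < r /\ ubound (ratios k) (gk k r / r).
Proof.
move=> k2.
pose f (r : R) := gk k r / r.
have K0 : 0 < kappa k :> R := kappa_gt0 k.
have gk1 (r : R) : gk k r <= 1 by rewrite gerBl expR_ge0.
pose v := f 1.
have v0 : 0 < v by rewrite /v /f divr1 subr_gt0 expR_lt1 oppr_lt0 expr1n mulr1.
have v1 : v <= 1 by rewrite /v /f divr1.
pose d := Num.min 1 (v / kappa k).
have d0 : 0 < d by rewrite lt_min ltr01 divr_gt0.
have d1 : d <= 1 by rewrite ge_min lexx.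
have M1 : 1 <= v^-1 by rewrite invf_ge1.
have cf : {within `[d, v^-1], continuous f}.
  apply: continuous_in_subspaceT => x; rewrite inE/= in_itv/= => /andP[dx _].
  have x0 : x != 0 by rewrite gt_eqF// (lt_le_trans d0).
  have c1 : (fun y : R => - (kappa k * y ^+ k)) @ x --> - (kappa k * x ^+ k).
    exact: (cvgN (cvgMl_tmp (@exprn_continuous R k x))).
  have c2 : (fun y : R => gk k y) @ x --> gk k x.
    apply: cvgB; first exact: cvg_cst.
    exact: (continuous_cvg _ (@continuous_expR R _) c1).
  exact: (cvgM c2 (cvgV x0 cvg_id)).
have [c cI cmax] := EVT_max (le_trans d1 M1) cf.
have c0 : 0 < c by move: cI; rewrite in_itv/= => /andP[dc _]; exact: lt_le_trans dc.
have vc : v <= f c by apply: cmax; rewrite in_itv/= d1.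
exists c; split => // _ [r /= r0 <-]; rewrite -/(f r) -/(f c).
have [dr|rd] := leP d r; last first.
  apply: le_trans vc; rewrite ler_pdivrMr// (le_trans (gk_le k r))//.
  move: rd; rewrite lt_min => /andP[r1 rv].
  move: rv; rewrite ltr_pdivlMr// => rv.
  apply: (@le_trans _ _ (kappa k * r ^+ 2)).
    by rewrite ler_wpM2l ?kappa_ge0// ler_wiXn2l ?ltW.
  by rewrite expr2 mulrA ler_wpM2r ?(ltW r0)// mulrC ltW.
have [rM|Mr] := leP r v^-1; first by apply: cmax; rewrite in_itv/= dr.
apply: le_trans vc; rewrite ler_pdivrMr// (le_trans (gk1 r))//.
by rewrite mulrC -ler_pdivrMr// div1r ltW.
Qed.

Lemma rkP k : (2 <= k)%N ->
  0 < rk k :> R /\ ubound (ratios k) (gk k (rk k) / rk k : R).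
Proof.
move=> k2; exact: (@xgetPex _ 0 [set r : R | 0 < r /\ ubound (ratios k) (gk k r / r)]
  (ratio_max k2)).
Qed.

Lemma CkE k : (2 <= k)%N -> Ck k = gk k (rk k) / rk k :> R.
Proof.
move=> k2; have [r0 ur] := rkP k2.
by rewrite /Ck k2; apply: set_maxE => //; exists (rk k).
Qed.

Lemma Ck_ub k : (0 < k)%N -> ubound (ratios k) (Ck k : R).
Proof.
case: k => [|[|k]]// _; first by rewrite Ck1; exact: ratios_le_kappa1.
by rewrite CkE//; exact: (rkP _).2.
Qed.

Lemma Ck_gt0 k : (0 < k)%N -> 0 < Ck k :> R.
Proof.
move=> k0; apply: (@lt_le_trans _ _ (gk k 1 / 1)); last first.
  by apply: Ck_ub => //; exists 1 => //=.
by rewrite divr1 subr_gt0 expR_lt1 oppr_lt0 expr1n mulr1 kappa_gt0.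
Qed.

End RatioMax.

(** * The uniform and the activation allocations *)

Section Allocations.
Context {R : realType}.
Variables (k n : nat) (b : R).
Hypotheses (k_gt0 : (0 < k)%N) (n_gt0 : (0 < n)%N) (b_gt0 : 0 < b).
Notation shrink := (n%:R `^ (- k%:R^-1) : R).

Let nR : (0 : R) < n%:R. Proof. by rewrite ltr0n. Qed.
Let nb : 0 < n%:R * b. Proof. exact: mulr_gt0. Qed.

Lemma allocation_upper (r : 'rV[R]_n) : allocations b r ->
  mu k r / (n%:R * b) <= (1 + 2 / n%:R) * Ck k.
Proof.
move=> [r0 rb]; rewrite ler_pdivrMr// -mulrA -rb.
by apply: mu_le_ratio => //; exact: Ck_ub.
Qed.

Lemma uniform_is_allocation : allocations b (const_mx b : 'rV[R]_n).
Proof.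
split => [i|]; first by rewrite mxE ltW.
by under eq_bigr do rewrite mxE; rewrite sumr_const card_ord mulr_natl.
Qed.

Lemma uniform_upper : Un k n b / (n%:R * b ^+ k) <= (1 + 2 / n%:R) * kappa k.
Proof.
rewrite ler_pdivrMr ?mulr_gt0 ?exprn_gt0//.
apply: (le_trans (mu_le_gk k_gt0 n_gt0 _)) => [i|]; first by rewrite mxE ltW.
rewrite -mulrA ler_wpM2l ?addr_ge0 ?divr_ge0//.
under eq_bigr do rewrite mxE.
rewrite sumr_const card_ord -[leLHS]mulr_natl mulrCA ler_wpM2l//.
exact: gk_le.
Qed.

Lemma uniform_lower : b * shrink <= 2^-1 ->
  (1 - 2 * (b * shrink)) ^+ k * (kappa k / (1 + kappa k * b ^+ k)) -
    kappa k ^+ 2 * b ^+ k <= Un k n b / (n%:R * b ^+ k).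
Proof.
move=> b2; have bk : 0 < b ^+ k by rewrite exprn_gt0.
have K0 := kappa_gt0 k : 0 < kappa k :> R.
rewrite ler_pdivlMr ?mulr_gt0//.
have := @mu_ge R k n k_gt0 n_gt0 (const_mx b) [set: 'I_n]%SET b (ltW b_gt0)
  (fun i _ => mxE _ _ _ _) b2.
rewrite cardsT card_ord; apply: le_trans.
have g0 : kappa k * b ^+ k / (1 + kappa k * b ^+ k) <= gk k b.
  by apply: onem_expRN_ge; rewrite mulr_ge0// ltW.
have t0 : 0 <= (1 - 2 * (b * shrink)) ^+ k by rewrite exprn_ge0//; lra.
have D0 : 0 < 1 + kappa k * b ^+ k by rewrite addr_gt0// mulr_gt0.
rewrite mulrBl lerB//.
  rewrite mulrCA ler_pM2l// -mulrA ler_wpM2l//.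
  by rewrite mulrAC.
rewrite le_eqVlt; apply/orP; left; apply/eqP; field.
by rewrite gt_eqF.
Qed.

Section Activation.
Hypotheses (k_ge2 : (2 <= k)%N) (b_lt : b < rk k).
Variable s : 'S_n.
Notation m := (Num.truncn (n%:R * b / rk k)).

Let rk0 : 0 < rk k :> R := (rkP k_ge2).1.
Let x0 : 0 <= n%:R * b / rk k. Proof. by rewrite divr_ge0 ?ltW. Qed.

Lemma active_lt : (m < n)%N.
Proof. by rewrite truncn_lt_nat// ltr_pdivrMr// ltr_pM2l. Qed.

Lemma activation_is_allocation : allocations b (activation k b s).
Proof.
have /andP[mx _] := truncn_itv x0.
have eta0 : 0 <= n%:R * b - m%:R * rk k.
  by rewrite subr_ge0 -ler_pdivlMr.
split => [i|]; first by rewrite mxE; case: ifP => _; [exact: ltW|case: ifP].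
under eq_bigr do rewrite mxE.
transitivity (\sum_(j < n) (if (j < m)%N then rk k
    else if j == m :> nat then n%:R * b - m%:R * rk k else 0)).
  by rewrite [RHS](reindex_inj (@perm_inj _ s)).
rewrite (bigD1 (Ordinal active_lt))//= ltnn eqxx.
rewrite (eq_bigr (fun j : 'I_n => if (j < m)%N then rk k else 0)); last first.
  by move=> j jm; case: ifP => // _; rewrite ifN.
rewrite -big_mkcondr/= (eq_bigl (fun j : 'I_n => (j < m)%N)); last first.
  move=> j /=; case: ltnP => [jm|_]; rewrite ?andbF// andbT.
  by rewrite -val_eqE/= ltn_eqF.
rewrite -(big_ord_widen n (fun=> rk k) (ltnW active_lt)).
by rewrite sumr_const card_ord -[X in _ + X]mulr_natl subrK.
Qed.

(** Each of the [m] active nodes covers with probability close to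
    [gk k (rk k)], and [m] exceeds [n * b / rk k - 1]; contention costs a
    fraction of order [b]. *)
Lemma activation_lower : rk k * shrink <= 2^-1 ->
  ((rk k)^-1 - (n%:R * b)^-1) * ((1 - 2 * (rk k * shrink)) ^+ k * gk k (rk k)) -
    (kappa k * rk k ^+ k) ^+ 2 / rk k ^+ 2 * b <=
  mu k (activation k b s) / (n%:R * b).
Proof.
move=> r2; have /andP[mx xm] := truncn_itv x0.
pose A := [set i : 'I_n | (s i < m)%N]%SET.
have cA : #|A| = m.
  rewrite -sum1dep_card.
  transitivity (\sum_(j < n | (j < m)%N) 1)%N.
    by rewrite [RHS](reindex_inj (@perm_inj _ s)).
  by rewrite -(big_ord_widen n (fun=> 1%N) (ltnW active_lt)) sum1_card card_ord.
have rA i : i \in A -> activation k b s 0 i = rk k.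
  by rewrite inE mxE => ->.
have := @mu_ge R k n k_gt0 n_gt0 (activation k b s) A (rk k) (ltW rk0) rA r2.
rewrite cA ler_pdivlMr//; apply: le_trans.
rewrite mulrBl lerB//.
  rewrite mulrAC ler_wpM2r//.
    rewrite mulr_ge0 ?gk_ge0 ?(ltW rk0)// exprn_ge0//; lra.
  rewrite mulrBl mulVf ?gt_eqF// mulrC lerBlDr natr1; exact: ltW.
set c := (kappa k * _) ^+ 2.
have -> : c / rk k ^+ 2 * b * (n%:R * b) = (n%:R * b / rk k) ^+ 2 * c / n%:R.
  by field; rewrite !gt_eqF.
rewrite ler_wpM2r ?invr_ge0// ler_wpM2r ?sqr_ge0//.
by rewrite lerXn2r ?nnegrE.
Qed.

End Activation.

End Allocations.

(** * Limits *)

Section Limits.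
Context {R : realType}.
Variables (k : nat) (b : nat -> R).
Hypothesis k_gt0 : (0 < k)%N.
Hypothesis b_lim : b n @[n --> \oo] --> 0.
Hypothesis nb_lim : n%:R * b n @[n --> \oo] --> +oo.
Notation shrink n := (n%:R `^ (- k%:R^-1) : R).

Lemma cvg_invn : (n%:R^-1 : R) @[n --> \oo] --> 0.
Proof.
apply/gtr0_cvgV0; last exact: cvgr_idn.
by near=> n; rewrite ltr0n; near: n; exact: nbhs_infty_gt.
Unshelve. all: by end_near. Qed.

Lemma near_gt0 : \forall n \near \oo, (0 < n)%N.
Proof. exact: nbhs_infty_gt. Qed.

(** Its k-th power is [1 / n]. *)
Lemma cvg_shrink : shrink n @[n --> \oo] --> (0 : R).
Proof.
apply/cvgrPdist_lt => e e0.
have ek0 : 0 < e ^+ k by rewrite exprn_gt0.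
have /cvgrPdist_lt/(_ _ ek0) H := cvg_invn.
near=> n.
have n0 : (0 < n)%N by near: n; exact: near_gt0.
have Hn : `|0 - (n%:R^-1 : R)| < e ^+ k by near: n.
move: Hn; rewrite !sub0r !normrN !ger0_norm ?powR_ge0 ?invr_ge0//.
have -> : n%:R^-1 = shrink n ^+ k.
  rewrite -powR_mulrn ?powR_ge0// -powRrM mulNr mulVf ?pnatr_eq0 -?lt0n//.
  by rewrite powR_inv1.
by rewrite ltr_pXn2r ?nnegrE ?powR_ge0// ltW.
Unshelve. all: by end_near. Qed.

Lemma near_nb_gt0 : \forall n \near \oo, 0 < n%:R * b n.
Proof. by move/cvgryPgt : nb_lim; exact. Qed.

Lemma near_b_gt0 : \forall n \near \oo, 0 < b n.
Proof.
near=> n; have : 0 < n%:R * b n by near: n; exact: near_nb_gt0.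
have n0 : (0 < n)%N by near: n; exact: near_gt0.
by rewrite pmulr_rgt0// ltr0n.
Unshelve. all: by end_near. Qed.

Lemma cvg_inv_nb : (n%:R * b n)^-1 @[n --> \oo] --> 0.
Proof. by apply/gtr0_cvgV0 => //; exact: near_nb_gt0. Qed.

Lemma cvg_onep_invn_mul (c : R) : (1 + 2 / n%:R) * c @[n --> \oo] --> c.
Proof.
rewrite -[X in _ --> X]mul1r; apply: cvgMr_tmp.
rewrite -[X in _ --> X]addr0; apply: cvgD; first exact: cvg_cst.
by rewrite -[X in _ --> X](mulr0 2); apply: cvgMl_tmp; exact: cvg_invn.
Qed.

Lemma cvg_boundary (f : nat -> R) : f n @[n --> \oo] --> 0 ->
  (1 - 2 * f n) ^+ k @[n --> \oo] --> (1 : R).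
Proof.
move=> f0; rewrite -[X in _ --> X](expr1n _ k).
apply: (continuous_cvg _ (@exprn_continuous R k _)).
rewrite -[X in _ --> X]subr0; apply: cvgB; first exact: cvg_cst.
by rewrite -[X in _ --> X](mulr0 2); apply: cvgMl_tmp.
Qed.

Lemma near_le_half (f : nat -> R) : f n @[n --> \oo] --> 0 ->
  \forall n \near \oo, f n <= 2^-1.
Proof.
move=> /cvgrPdist_le/(_ 2^-1 (ltac:(by rewrite invr_gt0)))H.
near=> n; apply: (le_trans (ler_norm _)); rewrite -normrN -sub0r.
by near: n.
Unshelve. all: by end_near. Qed.

Lemma cvg_bk : b n ^+ k @[n --> \oo] --> 0.
Proof.
rewrite [X in _ --> X](_ : _ = 0 ^+ k :> R); last by rewrite expr0n gtn_eqF.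
exact: (continuous_cvg _ (@exprn_continuous R k _) b_lim).
Qed.

Lemma cvg_b_shrink : b n * shrink n @[n --> \oo] --> 0.
Proof. by rewrite -[X in _ --> X](mulr0 0); apply: cvgM => //; exact: cvg_shrink. Qed.

Lemma cvg_Un : Un k n (b n) / (n%:R * b n ^+ k) @[n --> \oo] --> kappa k.
Proof.
apply: (@squeeze_cvgr _ _ _ _
  (fun n => (1 - 2 * (b n * shrink n)) ^+ k * (kappa k / (1 + kappa k * b n ^+ k)) -
    kappa k ^+ 2 * b n ^+ k) (fun n => (1 + 2 / n%:R) * kappa k)).
- near=> n.
  have n0 : (0 < n)%N by near: n; exact: near_gt0.
  have b0 : 0 < b n by near: n; exact: near_b_gt0.
  rewrite uniform_upper// andbT uniform_lower//.
  by near: n; exact: near_le_half cvg_b_shrink.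
- rewrite [X in _ --> X](_ : _ =
      1 * (kappa k / (1 + kappa k * 0)) - kappa k ^+ 2 * 0); last first.
    by rewrite !mulr0 addr0 divr1 mul1r subr0.
  apply: cvgB; last by apply: cvgMl_tmp; exact: cvg_bk.
  apply: cvgM; first by apply: cvg_boundary; exact: cvg_b_shrink.
  apply: cvgMl_tmp; apply: cvgV; first by rewrite mulr0 addr0 oner_eq0.
  by apply: cvgD; [exact: cvg_cst|apply: cvgMl_tmp; exact: cvg_bk].
- exact: cvg_onep_invn_mul.
Unshelve. all: by end_near. Qed.

Lemma near_b_lt_rk : \forall n \near \oo, (2 <= k)%N -> b n < rk k.
Proof.
have [k2|k1] := leqP 2 k; last by near=> n.
by near=> n => _; near: n; exact: (cvgr_lt _ b_lim _ (rkP k2).1).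
Unshelve. all: by end_near. Qed.

Lemma cvg_activation (s : forall n, 'S_n) : (2 <= k)%N ->
  mu k (activation k (b n) (s n)) / (n%:R * b n) @[n --> \oo] --> Ck k.
Proof.
move=> k2; have [r0 _] := @rkP R k k2.
have rs : rk k * shrink n @[n --> \oo] --> (0 : R).
  by rewrite -[X in _ --> X](mulr0 (rk k)); apply: cvgMl_tmp; exact: cvg_shrink.
apply: (@squeeze_cvgr _ _ _ _ (fun n =>
  ((rk k)^-1 - (n%:R * b n)^-1) * ((1 - 2 * (rk k * shrink n)) ^+ k * gk k (rk k)) -
    (kappa k * rk k ^+ k) ^+ 2 / rk k ^+ 2 * b n) (fun n => (1 + 2 / n%:R) * Ck k)).
- near=> n.
  have n0 : (0 < n)%N by near: n; exact: near_gt0.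
  have bn0 : 0 < b n by near: n; exact: near_b_gt0.
  have brk : b n < rk k by near: n; apply: filterS near_b_lt_rk => n; exact.
  rewrite allocation_upper// ?andbT; last exact: activation_is_allocation.
  by rewrite activation_lower//; near: n; exact: near_le_half.
- rewrite [X in _ --> X](_ : _ = ((rk k)^-1 - 0) * (1 * gk k (rk k)) -
      (kappa k * rk k ^+ k) ^+ 2 / rk k ^+ 2 * 0); last first.
    by rewrite subr0 mul1r mulr0 subr0 mulrC CkE.
  apply: cvgB; last exact: cvgMl_tmp.
  apply: cvgM; first by apply: cvgB; [exact: cvg_cst|exact: cvg_inv_nb].
  by apply: cvgMr_tmp; exact: cvg_boundary.
- exact: cvg_onep_invn_mul.
Unshelve. all: by end_near. Qed.

(** The lower bound comes from activation when k >= 2 and from the uniform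
    allocation when k = 1, where the supremum of the ratios is approached as the
    radius tends to 0. *)
Lemma cvg_OPT : OPT k n (b n) / (n%:R * b n) @[n --> \oo] --> Ck k.
Proof.
pose lower n : R := if k == 1%N then Un k n (b n)
  else mu k (activation k (b n) (1 : 'S_n)%g).
apply: (@squeeze_cvgr _ _ _ _
  (fun n => lower n / (n%:R * b n)) (fun n => (1 + 2 / n%:R) * Ck k)).
- near=> n.
  have n0 : (0 < n)%N by near: n; exact: near_gt0.
  have bn0 : 0 < b n by near: n; exact: near_b_gt0.
  have brk : (2 <= k)%N -> b n < rk k by near: n; exact: near_b_lt_rk.
  have [r [ra -> rmax]] := @OPT_attained R k n (b n) k_gt0 (ltW bn0).
  rewrite allocation_upper// andbT ler_wpM2r ?invr_ge0 ?mulr_ge0 ?(ltW bn0)//.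
  rewrite /lower; case: eqP => [_|/eqP k1]; first by apply: rmax; exact: uniform_is_allocation.
  have k2 : (2 <= k)%N by rewrite ltn_neqAle eq_sym k1.
  by apply: rmax; apply: activation_is_allocation => //; exact: brk.
- rewrite /lower; case: eqP => [k1|/eqP k1].
    have -> : Ck k = kappa k :> R by rewrite k1 Ck1.
    rewrite (_ : (fun n => _) = (fun n => Un k n (b n) / (n%:R * b n ^+ k))).
      exact: cvg_Un.
    by apply/funext => n; rewrite k1 expr1.
  by apply: cvg_activation; rewrite ltn_neqAle eq_sym k1.
- exact: cvg_onep_invn_mul.
Unshelve. all: by end_near. Qed.

Lemma cvg_exprB1 : b n ^+ (k - 1) @[n --> \oo] --> (if k == 1%N then 1 else 0 : R).
Proof.
case: eqP => [->|/eqP k1].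
  by rewrite subnn; under eq_fun do rewrite expr0; exact: cvg_cst.
rewrite [X in _ --> X](_ : _ = 0 ^+ (k - 1) :> R).
  exact: (continuous_cvg _ (@exprn_continuous R (k - 1) _) b_lim).
by rewrite expr0n subn_eq0 leqNgt ltn_neqAle eq_sym k1 k_gt0.
Qed.

End Limits.

Unset Implicit Arguments.
Set Strict Implicit.
Set Printing Implicit Defensive.

(** * The scaling limits *)

Theorem theorem2 (R : realType) (k : nat) (hk : (1 <= k)%N) (b : nat -> R)
    (hb_ge0 : forall n : nat, (1 <= n)%N -> 0 <= b n)
    (hb_lim : b n @[n --> \oo] --> 0)
    (hnb_lim : n%:R * b n @[n --> \oo] --> +oo) :
  [/\ OPT k n (b n) / (n%:R * b n) @[n --> \oo] --> Ck k,
      (2 <= k)%N -> forall s : forall n : nat, 'S_n,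
        mu k (activation k (b n) (s n)) / (n%:R * b n) @[n --> \oo] --> Ck k,
      Un k n (b n) / (n%:R * b n ^+ k) @[n --> \oo] --> kappa k
    & [/\ cvg (b n ^+ (k - 1) @[n --> \oo]),
          Un k n (b n) / OPT k n (b n) @[n --> \oo] -->
            kappa k / Ck k * lim (b n ^+ (k - 1) @[n --> \oo])
        & kappa k / Ck k * lim (b n ^+ (k - 1) @[n --> \oo]) =
            (if k == 1%N then 1 else 0)]].
Proof.
have cO := cvg_OPT hk hb_lim hnb_lim.
have cU := cvg_Un hk hb_lim hnb_lim.
have cb := cvg_exprB1 hk hb_lim.
have limb := cvg_lim (@Rhausdorff R) cb.
split => //; first by move=> k2 s; exact: cvg_activation.
split; first exact: cvgP cb.
- rewrite limb.
  apply: (cvg_trans _ (cvgM (cvgM cU (cvgV (lt0r_neq0 (Ck_gt0 hk)) cO)) cb)).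
  apply: near_eq_cvg; near=> n.
  have n0 : (n%:R : R) != 0.
    by rewrite pnatr_eq0 -lt0n; near: n; exact: near_gt0.
  have b0 : b n != 0 by rewrite lt0r_neq0//; near: n; exact: near_b_gt0.
  have bkE : b n ^+ k = b n * b n ^+ (k - 1) by rewrite -exprS subn1 prednK.
  rewrite /= invf_div bkE.
  have bk0 : b n ^+ (k - 1) != 0 by rewrite expf_neq0.
  have [->|O0] := eqVneq (OPT k n (b n)) 0; first by rewrite invr0 !(mulr0, mul0r).
  by field; rewrite O0 b0 n0 bk0.
rewrite limb; case: eqP => [->|_]; last by rewrite mulr0.
by rewrite Ck1 divff ?mulr1// lt0r_neq0// kappa_gt0.
Unshelve. all: by end_near. Qed.
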